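(* Let $M$ be a connected Riemannian manifold without boundary of dimension $m \geq 1$, let $a \in M$, and let $L > 1$. Then there exists an $r_0 > 0$ such that for all $r \in (0, r_0)$ we have $$ d_{GH}(M \setminus B_r(a), M) \leq L \cdot \sqrt{\frac{m+1}{2m}}\; d_H(M \setminus B_r(a), M) \quad \text{and} \quad d_H(M \setminus B_r(a), M) = r , $$ where $M \setminus B_r(a)$ is equipped with the subspace metric.
   Context: $M$ is equipped with the Riemannian distance function $d$ induced by its Riemannian metric; $M$ is not assumed to be compact or complete. $B_r(a)=\{p\in M: d(a,p)<r\}$ is the open ball. The subspace metric on $M\setminus B_r(a)$ is the restriction of $d$ (not an induced length metric). $d_H$ denotes the Hausdorff distance between subsets of the metric space $M$. The Gromov--Hausdorff distance is used in its standard, unpointed form for possibly non-compact metric spaces $X$, $Y$: $d_{GH}(X,Y)$ is the infimum of $d_H^Z(X',Y')$ over all metric spaces $Z$ and images $X',Y'\subseteq Z$ of isometric (distance-preserving) embeddings of $X$, $Y$ into $Z$. Equivalently, $d_{GH}(X,Y)=\frac12\inf_R \operatorname{dis}(R)$ over all correspondences $R\subseteq X\times Y$, i.e. relations such that every element of either set is related to some element of the other, where $\operatorname{dis}(R)=\sup\{|d_X(x,x')-d_Y(y,y')| : (x,y),(x',y')\in R\}$. *)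

(* Defs.v *)
From HB Require Import structures.
From mathcomp Require Import all_boot all_order all_algebra.
From mathcomp Require Import all_classical all_reals all_analysis.

Set Implicit Arguments.
Unset Strict Implicit.
Unset Printing Implicit Defensive.

Import Order.TTheory GRing.Theory Num.Theory.
Import numFieldNormedType.Exports.

Local Open Scope classical_set_scope.
Local Open Scope ring_scope.

(** Intended for [U] open; continuity of all iterated directional derivatives
    up to order [k], which in finite dimension is the usual C^k condition. *)
Fixpoint Ck_on (R : realType) (V W : normedModType R) (k : nat)
    (U : set V) (f : V -> W) : Prop :=
  {in U, continuous f} /\
  if k is k'.+1 then
    forall v : V, (forall x, U x -> derivable f x v) /\
                  Ck_on k' U (fun x => 'D_v f x)
  else True.

Definition smooth_on (R : realType) (V W : normedModType R)
    (U : set V) (f : V -> W) : Prop :=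
  forall k, Ck_on k U f.

(** A homeomorphism from an open subset of [M] onto an open subset of R^m.
    Both maps are total functions, with irrelevant values off [chart_dom] and
    its image. *)
Record chart (R : realType) (m : nat) (M : topologicalType) := Chart {
  chart_dom : set M ;
  chart_map :> M -> 'rV[R]_m ;
  chart_inv : 'rV[R]_m -> M ;
  chart_dom_open : open chart_dom ;
  chart_img_open : open (chart_map @` chart_dom) ;
  chart_mapK : {in chart_dom, cancel chart_map chart_inv} ;
  chart_map_cont : {in chart_dom, continuous chart_map} ;
  chart_inv_cont : {in chart_map @` chart_dom, continuous chart_inv}
}.

(** The transition map is [c' \o chart_inv c] on [overlap c c']. *)
Definition overlap (R : realType) (m : nat) (M : topologicalType)
    (c c' : chart R m M) : set 'rV[R]_m :=
  c @` (chart_dom c `&` chart_dom c').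

Record smooth_manifold (R : realType) (m : nat) (M : topologicalType) :=
    SmoothManifold {
  manifold_hausdorff : hausdorff_space M ;
  manifold_countable : @second_countable M ;
  atlas : set (chart R m M) ;
  chart_at : M -> chart R m M ;
  chart_at_atlas : forall p, atlas (chart_at p) ;
  chart_at_dom : forall p, chart_dom (chart_at p) p ;
  atlas_smooth : forall c c', atlas c -> atlas c' ->
    smooth_on (overlap c c') (c' \o chart_inv c)
}.

Definition bilin (R : realType) (m : nat) (G : 'M[R]_m) (u v : 'rV[R]_m) : R :=
  (u *m G *m v^T) 0 0.

(** The metric tensor is given by its matrix [gram c x] in each chart [c] of the
    atlas, at the point of coordinates [x]; [gram_compat] says that these
    matrices represent one and the same inner product on each tangent space. *)
Record riemannian_metric (R : realType) (m : nat) (M : topologicalType)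
    (S : smooth_manifold R m M) := RiemannianMetric {
  gram : chart R m M -> 'rV[R]_m -> 'M[R]_m ;
  gram_smooth : forall c, atlas S c ->
    smooth_on (c @` chart_dom c) (gram c) ;
  gram_sym : forall c x, atlas S c -> (c @` chart_dom c) x ->
    (gram c x)^T = gram c x ;
  gram_posdef : forall c x (u : 'rV[R]_m), atlas S c -> (c @` chart_dom c) x ->
    u != 0 -> 0 < bilin (gram c x) u u ;
  gram_compat : forall c c' x u v, atlas S c -> atlas S c' ->
    overlap c c' x ->
    let tau := c' \o chart_inv c in
    bilin (gram c x) u v = bilin (gram c' (tau x)) ('D_u tau x) ('D_v tau x)
}.

Section riemannian_distance.
Variables (R : realType) (m : nat) (M : topologicalType).
Variables (S : smooth_manifold R m M) (g : riemannian_metric S).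

Definition C1_curve_at (sigma : R -> M) (t : R) : Prop :=
  exists c (U : set R), [/\ atlas S c, open U, U t,
    sigma @` U `<=` chart_dom c & Ck_on 1 U (c \o sigma)].

(** On each closed piece [gamma] is the restriction of a C^1 curve defined on a
    neighbourhood of the piece; continuity of [gamma] on [0, 1] follows, since
    consecutive pieces share their endpoint. *)
Definition piecewise_C1 (gamma : R -> M) : Prop :=
  exists (n : nat) (t : nat -> R),
    [/\ t 0%N = 0, t n = 1 &
        forall i, (i < n)%N -> t i < t i.+1 /\
          exists sigma : R -> M, forall x, t i <= x <= t i.+1 ->
            C1_curve_at sigma x /\ gamma x = sigma x].

(** The norm of [gamma'(t)]. By [gram_compat] the choice of chart around
    [gamma t] is irrelevant wherever [gamma] is differentiable. *)
Definition speed (gamma : R -> M) (t : R) : R :=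
  let c := chart_at S (gamma t) in
  let v := derive1 (c \o gamma) t in
  Num.sqrt (bilin (gram g c (c (gamma t))) v v).

Definition curve_length (gamma : R -> M) : \bar R :=
  (\int[lebesgue_measure]_(t in `[0%R, 1%R]) (speed gamma t)%:E)%E.

(** On a connected manifold the infimum is over a nonempty set of finite
    lengths, so [fine] loses nothing. *)
Definition rdist (p q : M) : R :=
  fine (ereal_inf [set curve_length gamma | gamma in
    [set gamma | piecewise_C1 gamma /\ gamma 0 = p /\ gamma 1 = q]]).

Definition rball (a : M) (r : R) : set M := [set p | rdist a p < r].

End riemannian_distance.

(** An infimum over no admissible value is [+oo], here and for the
    Gromov-Hausdorff distance. *)
Definition hausdorff_dist (R : realType) (T : Type) (d : T -> T -> R)
    (A B : set T) : \bar R :=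
  ereal_inf [set e%:E | e in [set e : R | [/\ 0 < e,
    (forall x, A x -> exists2 y, B y & d x y < e) &
    (forall y, B y -> exists2 x, A x & d x y < e)]]].

Definition gromov_hausdorff_dist (R : realType) (X Y : Type)
    (dX : X -> X -> R) (dY : Y -> Y -> R) : \bar R :=
  ereal_inf [set e | exists (Z : metricType R) (f : X -> Z) (h : Y -> Z),
    [/\ forall x x', mdist (f x) (f x') = dX x x',
        forall y y', mdist (h y) (h y') = dY y y' &
        e = hausdorff_dist (@mdist R Z) (range f) (range h)]].

Definition subspace_dist (R : realType) (T : Type) (d : T -> T -> R)
    (A : set T) : A -> A -> R :=
  fun x y => d (set_val x) (set_val y).

(* Main.v *)
(** Upper bound for [d_GH]: let [v_0, .., v_m] be the unit vectors to the vertices of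
    a regular simplex. Since they sum to zero, every vector [x] of R^m satisfies
    [<x, v_i> >= 0] for some [i], hence [|x + r v_i| >= r]. Moving the points of the
    ball of radius [r] along such a [r v_i] and fixing the others, all displacements
    lie in [{0, r v_0, .., r v_m}], whose diameter is the edge
    [r sqrt (2 (m + 1) / m)]; this bounds the distortion, and [d_GH] is half of it.
    In a chart around [a] the distance is Euclidean up to a factor [1 +- C r], which
    [L] absorbs.

    [d_H = r]: the point [a] gives [>=]. For [<=], a point [y] of the ball has to be
    within [r + eta] of a point [x] with [d(a, x) = r]; take [x] on the coordinate ray
    through [y] and repeatedly take approximate midpoints [z_k] between [a] and
    [z_(k-1)], starting at [z_0 = x]. As the metric is Lipschitz, the directions of the
    [z_k] stay close to that of [x], so at the scale of [y] some [z_k] satisfies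
    [d(y, z_k) <= d(a, z_k)], and then [d(y, x) <= d(a, z_k) + d(z_k, x)] is almost
    [r]. *)

Require Import Defs.
From HB Require Import structures.
From mathcomp Require Import all_boot all_order all_algebra.
From mathcomp Require Import all_classical all_reals all_analysis.
From mathcomp Require Import measurable_realfun ring lra.

Set Implicit Arguments.
Unset Strict Implicit.
Unset Printing Implicit Defensive.

Import Order.TTheory GRing.Theory Num.Theory.
Import numFieldNormedType.Exports.

Local Open Scope classical_set_scope.
Local Open Scope ring_scope.

(** * Continuously differentiable maps are differentiable *)

(** The two claims need different precision. The factor [L] leaves room for first-order errors, so
    for [d_GH] a comparison in an arbitrary chart is enough. The equality [d_H = r] leaves none: a
    coordinate segment bounds a distance only up to a factor [1 + C r] and cannot give [r] itself.
    The exact value has to come from the distance being a length metric. As [M] may be incomplete,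
    minimizing geodesics are replaced by approximate midpoints, obtained by cutting almost minimal
    curves; the chart then only controls directions, where crude margins suffice. Lower bounds for
    the distance must also cover curves that leave the chart: these are followed only up to their
    first exit from a coordinate ball. Finally [d_GH] asks for an ambient metric space, so the map
    of small distortion is turned into a metric on a disjoint union. *)

Lemma mx_entry_le_norm (R : realType) p q (A : 'M[R]_(p, q)) i j :
  `|A i j| <= `|A|.
Proof.
rewrite [leRHS]/Num.Def.normr/= mx_normrE.
exact: (le_bigmax 0 (fun k : 'I_p * 'I_q => `|A k.1 k.2|) (i, j)).
Qed.

Lemma mx_norm_le (R : realType) p q (A : 'M[R]_(p, q)) (e : R) : 0 <= e ->
  (forall i j, `|A i j| <= e) -> `|A| <= e.
Proof.
move=> e0 Ae; rewrite [leLHS]/Num.Def.normr/= mx_normrE.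
by rewrite (bigmax_le _ e0)//= => -[i j] _ /=; exact: Ae.
Qed.

Lemma is_derive_line (R : realType) (V W : normedModType R) (f : V -> W)
    (y v : V) (t : R) : derivable f (y + t *: v) v ->
  is_derive t 1 (fun s : R => f (y + s *: v)) ('D_v f (y + t *: v)).
Proof.
move=> fv; have E : (fun h : R => h^-1 *: (f (y + (h *: 1 + t) *: v) - f (y + t *: v)))
  = (fun h : R => h^-1 *: (f (h *: v + (y + t *: v)) - f (y + t *: v))).
  apply/funext => h; congr (_ *: (f _ - _)).
  by rewrite [_%:A]mulr1 scalerDl addrCA addrA.
by constructor; rewrite /derivable /derive /comp /= E.
Qed.

(** The norm on matrices is the maximum over the entries, so the scalar mean value theorem applies
    to each entry; the intermediate point may depend on the entry because the derivative is
    controlled all along the segment. *)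
Lemma mean_value_line (R : realType) p q (V : normedModType R)
    (f : V -> 'M[R]_(p, q)) (y v : V) (c e : R) l : 0 <= e ->
  (forall t, `|t| <= `|c| -> derivable f (y + t *: v) v /\
     `|l - 'D_v f (y + t *: v)| <= e) ->
  `|f (y + c *: v) - f y - c *: l| <= e * `|c|.
Proof.
move=> e0 fe; apply: mx_norm_le => [|i j]; first by rewrite mulr_ge0.
pose g (t : R) := f (y + t *: v) i j.
have dg t : `|t| <= `|c| -> is_derive t (1 : R) g ('D_v f (y + t *: v) i j).
  move=> /fe[dft _]; have [d1 d2] := is_derive_line dft.
  constructor; first exact: (proj1 (derivable_mxP _ _ _) d1).
  by move: d2; rewrite derive_mx// => <-; rewrite mxE.
have ba : forall t, t \in `[Num.min 0 c, Num.max 0 c] -> `|t| <= `|c|.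
  move=> t; rewrite in_itv/= ge_min le_max; case: (leP 0 c) => c0.
    move=> /andP[/orP[t0|ct] /orP[t0'|ct']]; rewrite ?(ger0_norm c0) ler_norml; apply/andP; split; lra.
  move=> /andP[/orP[t0|ct] /orP[t0'|ct']]; rewrite ?(ltr0_norm c0) ler_norml; apply/andP; split; lra.
have le0 : Num.min 0 c <= Num.max 0 c by rewrite ge_min !le_max lexx.
have [||t tc gt] := @MVT_segment R g (fun t => 'D_v f (y + t *: v) i j) _ _ le0 _.
- move=> t tc; apply: dg; apply: ba; exact: subset_itv_oo_cc tc.
- apply: derivable_within_continuous => t tc.
  by have [] := dg _ (ba _ tc).
have E : g c - g 0 = 'D_v f (y + t *: v) i j * c.
  move: gt; case: (leP 0 c) => c0; first by rewrite subr0.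
  by rewrite sub0r mulrN => /eqP; rewrite -opprB eqr_opp => /eqP.
rewrite !mxE.
have -> : f (y + c *: v) i j - f y i j - c * l i j =
    - ((l - 'D_v f (y + t *: v)) i j * c).
  by move: E; rewrite /g scale0r addr0 !mxE => ->; ring.
rewrite normrN normrM ler_wpM2r//.
by apply: le_trans (mx_entry_le_norm _ _ _) _; have [] := fe _ (ba _ tc).
Qed.

Lemma linear_rV_continuous (R : realType) m (W : normedModType R)
    (f : {linear 'rV[R]_m -> W}) : continuous f.
Proof.
apply: bounded_linear_continuous; apply/linear_boundedP.
apply: (filterS _ (nbhs_pinfty_ge (num_real (\sum_(j < m) `|f 'e_j|)))) => r rS x.
rewrite {1}[x]row_sum_delta linear_sum (le_trans (ler_norm_sum _ _ _))//.
apply: (@le_trans _ _ (\sum_(j < m) `|x| * `|f 'e_j|)).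
  apply: ler_sum => j _; rewrite linearZ/= normrZ ler_wpM2r//.
  exact: mx_entry_le_norm.
by rewrite -mulr_sumr mulrC ler_wpM2r.
Qed.

Section C1_differentiable.
Variables (R : realType) (m p q : nat) (U : set 'rV[R]_m).
Variable f : 'rV[R]_m -> 'M[R]_(p, q).
Hypothesis oU : open U.
Hypothesis Cf : Ck_on 1 U f.

(** The points [x + trunc k h] form a staircase from [x] to [x + h], one coordinate at a time, so
    each step involves a single partial derivative. *)
Let trunc (k : nat) (h : 'rV[R]_m) : 'rV[R]_m :=
  \row_j (if (j < k)%N then h 0 j else 0).

Let truncS (j : 'I_m) h : trunc j.+1 h = trunc j h + h 0 j *: 'e_j.
Proof.
apply/rowP => i; rewrite !mxE eqxx/= ltnS leq_eqVlt.
rewrite val_eqE; have [->|ij] := eqVneq i j.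
  by rewrite ltnn/= mulr1 add0r.
by rewrite mulr0 addr0.
Qed.

Let trunc0 h : trunc 0 h = 0.
Proof. by apply/rowP => i; rewrite !mxE ltn0. Qed.

Let truncm h : trunc m h = h.
Proof. by apply/rowP => i; rewrite !mxE ltn_ord. Qed.

Let trunc_le (j : 'I_m) (h : 'rV[R]_m) (t : R) : `|t| <= `|h 0 j| -> `|trunc j h + t *: 'e_j| <= `|h|.
Proof.
move=> th; apply: mx_norm_le => // a i; rewrite !mxE ord1 eqxx/=.
have [->|ij] := eqVneq i j.
  by rewrite ltnn add0r mulr1 (le_trans th)// mx_entry_le_norm.
rewrite mulr0 addr0; case: ifP => _; last by rewrite normr0.
exact: mx_entry_le_norm.
Qed.

Let df x (h : 'rV[R]_m) := \sum_(j < m) h 0 j *: 'D_('e_j) f x.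

Let df_linear x : linear (df x).
Proof.
move=> k u v; rewrite /df scaler_sumr -big_split/=; apply: eq_bigr => j _.
by rewrite !mxE scalerDl scalerA.
Qed.

Let df_estimate x e : U x -> 0 < e -> \forall h \near (0 : 'rV[R]_m),
  `|f (h + x) - f x - df x h| <= e * `|h|.
Proof.
move=> Ux e0.
(* The [m] steps of the staircase have error at most [e' * |h|] each; dividing by [m.+1] also covers
   [m = 0]. *)
pose e' := e / m.+1%:R; have e'0 : 0 < e' by rewrite divr_gt0.
have [d d0 dU] : exists2 d : R, 0 < d & forall z, `|z| < d ->
    U (x + z) /\ forall j : 'I_m, `|'D_('e_j) f x - 'D_('e_j) f (x + z)| <= e'.
  have nU : \forall z \near x, U z by exact: open_nbhs_nbhs.
  have nD : \forall z \near x, forall j : 'I_m, `|'D_('e_j) f x - 'D_('e_j) f z| <= e'.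
    apply: (@filter_forall _ _
      (fun j : 'I_m => [set z | `|'D_('e_j) f x - 'D_('e_j) f z| <= e']) (nbhs x)) => j.
    have [_ [+ _]] := Cf.2 'e_j; move=> /(_ x); rewrite inE => /(_ Ux).
    by move=> /cvgrPdist_le /(_ _ e'0).
  have : nbhs x (U `&` [set z | forall j : 'I_m, `|'D_('e_j) f x - 'D_('e_j) f z| <= e']) by exact: filterI.
  move=> /nbhs_ballP[d /= d0 dP]; exists d => // z zd.
  by apply: dP; rewrite -ball_normE /= opprD addrA subrr sub0r normrN.
near=> h.
have hd : `|h| < d.
  near: h; apply/nbhs_ballP; exists d => // z.
  by rewrite -ball_normE/= sub0r normrN.
have T : f (h + x) - f x = \sum_(j < m) (f (x + trunc j.+1 h) - f (x + trunc j h)).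
  rewrite -(big_mkord xpredT (fun j => f (x + trunc j.+1 h) - f (x + trunc j h))).
  rewrite (telescope_sumr (fun k => f (x + trunc k h)) (leq0n m)).
  by rewrite truncm trunc0 addr0 [h + x]addrC.
rewrite T /df -sumrB (le_trans (ler_norm_sum _ _ _))//.
apply: (@le_trans _ _ (\sum_(j < m) e' * `|h|)); last first.
  rewrite sumr_const card_ord -mulrnAl ler_wpM2r// /e' -mulr_natr mulrAC.
  by rewrite ler_pdivrMr// ler_pM2l// ler_nat.
apply: ler_sum => j _.
rewrite truncS addrA (le_trans (mean_value_line (ltW e'0) _))//; last first.
  by rewrite ler_pM2l// mx_entry_le_norm.
move=> t tj; have zd : `|trunc j h + t *: 'e_j| < d.
  exact: le_lt_trans (trunc_le tj) hd.
have [Uz Dz] := dU _ zd; rewrite -addrA; split; last exact: Dz.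
exact: ((Cf.2 'e_j).1 _ Uz).
Unshelve. all: by end_near. Qed.

(** [Ck_on] controls directional derivatives only, whereas the chain rule for transition maps and
    the Lipschitz estimate of the metric need a Frechet derivative. *)
Lemma C1_differentiable x : U x -> differentiable f x.
Proof.
move=> Ux.
pose L : {linear 'rV[R]_m -> 'M[R]_(p, q)} :=
  HB.pack (df x) (GRing.isLinear.Build _ _ _ _ (df x) (df_linear x)).
have Lc : continuous L.
  exact: linear_rV_continuous.
have E : f \o shift x = cst (f x) + L +o_ (0 : 'rV[R]_m) id.
  apply/eqaddoP => e e0; near=> h => /=.
  rewrite [X in `|X|](_ : _ = f (h + x) - f x - df x h); last first.
    by rewrite -[LHS]/(f (h + x) - (f x + df x h)) opprD addrA.
  by near: h; exact: df_estimate.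
by apply/diff_locallyP; rewrite (diff_unique Lc E).
Unshelve. all: by end_near. Qed.
End C1_differentiable.

(** * Charts and the speed of curves *)

Lemma sum_cvg (R : realType) (V : normedModType R) (T I : Type) (F : set_system T) {FF : Filter F}
    (r : seq I) (f : I -> T -> V) (l : I -> V) :
  (forall i, f i x @[x --> F] --> l i) ->
  \sum_(i <- r) f i x @[x --> F] --> \sum_(i <- r) l i.
Proof. by move=> fl; apply: cvg_big => // x; exact: add_continuous. Qed.

Lemma bilinE (R : realType) m (G : 'M[R]_m) (u v : 'rV[R]_m) :
  bilin G u v = \sum_j (\sum_i u 0 i * G i j) * v 0 j.
Proof.
by rewrite /bilin mxE; apply: eq_bigr => j _; rewrite !mxE.
Qed.

Lemma mx_entry_cvg (R : realType) p q (T : Type) (F : set_system T) {FF : Filter F}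
    (f : T -> 'M[R]_(p, q)) (A : 'M[R]_(p, q)) i j :
  f x @[x --> F] --> A -> f x i j @[x --> F] --> A i j.
Proof.
move=> fA; apply: (@cvg_comp _ _ _ f (fun B : 'M[R]_(p, q) => B i j) _ (nbhs A)) => //.
exact: coord_continuous.
Qed.

Lemma bilin_cvg (R : realType) m (T : Type) (F : set_system T) {FF : Filter F}
    (G : T -> 'M[R]_m) (u v : T -> 'rV[R]_m) (G0 : 'M[R]_m) (u0 v0 : 'rV[R]_m) :
  G x @[x --> F] --> G0 -> u x @[x --> F] --> u0 -> v x @[x --> F] --> v0 ->
  bilin (G x) (u x) (v x) @[x --> F] --> bilin G0 u0 v0.
Proof.
move=> cG cu cv; rewrite bilinE.
rewrite [X in X @ _ --> _](_ : _ = fun x => \sum_j (\sum_i u x 0 i * G x i j) * v x 0 j); last first.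
  by apply/funext => x; rewrite bilinE.
apply: (@sum_cvg R R) => j; apply: cvgM; last exact: mx_entry_cvg cv.
by apply: (@sum_cvg R R) => i; apply: cvgM; [exact: mx_entry_cvg cu|exact: mx_entry_cvg cG].
Qed.

Section charts.
Variables (R : realType) (m : nat) (M : topologicalType).

Lemma near_chart_dom (c : chart R m M) p : chart_dom c p -> \forall q \near p, chart_dom c q.
Proof. by move=> cp; apply: open_nbhs_nbhs; split=> //; exact: chart_dom_open. Qed.

Lemma chart_mapK_dom (c : chart R m M) p : chart_dom c p -> chart_inv c (c p) = p.
Proof. by move=> cp; apply: chart_mapK; exact: mem_set. Qed.

Lemma chart_cvg (c : chart R m M) p : chart_dom c p -> c q @[q --> p] --> c p.
Proof. by move=> cp; apply: chart_map_cont; exact: mem_set. Qed.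

Lemma chart_inv_cvg (c : chart R m M) p : chart_dom c p ->
  chart_inv c x @[x --> c p] --> p.
Proof.
move=> cp; rewrite -[X in _ --> X](chart_mapK_dom cp).
by apply: chart_inv_cont; apply: mem_set; exists p.
Qed.

Lemma near_chart_img (c : chart R m M) p : chart_dom c p ->
  \forall x \near c p, (c @` chart_dom c) x.
Proof.
by move=> cp; apply: open_nbhs_nbhs; split; [exact: chart_img_open|exists p].
Qed.

Lemma overlap_open (c c' : chart R m M) : open (overlap c c').
Proof.
rewrite openE => _ [p [cp c'p] <-]; rewrite /interior.
have h1 := near_chart_img cp.
have h2 : \forall x \near c p, chart_dom c' (chart_inv c x).
  exact: (chart_inv_cvg cp (near_chart_dom c'p)).
near=> x.
have [q cq qx] : (c @` chart_dom c) x by near: x.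
exists q => //; split=> //.
have : chart_dom c' (chart_inv c x) by near: x.
by rewrite -qx chart_mapK_dom.
Unshelve. all: by end_near. Qed.

End charts.

Section curves.
Variables (R : realType) (m : nat) (M : topologicalType).
Variables (S : smooth_manifold R m M) (g : riemannian_metric S).

(** [speed] changes its chart with the point; here one chart stays fixed, so that continuity in [t]
    can be read off. *)
Definition chart_speed (c : chart R m M) (sigma : R -> M) (t : R) : R :=
  Num.sqrt (bilin (gram g c (c (sigma t))) (derive1 (c \o sigma) t)
                                           (derive1 (c \o sigma) t)).

Lemma transition_differentiable c c' x : atlas S c -> atlas S c' ->
  overlap c c' x -> differentiable (c' \o chart_inv c) x.
Proof.
move=> Sc Sc' ox.
exact: (C1_differentiable (@overlap_open _ _ _ c c') (atlas_smooth Sc Sc' 1%N) ox).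
Qed.

Lemma C1_curve_cvg (sigma : R -> M) t : C1_curve_at S sigma t ->
  sigma x @[x --> t] --> sigma t.
Proof.
move=> [c [U [Sc oU Ut sU [C0 _]]]].
have ct : chart_dom c (sigma t) by apply: sU; exists t.
have h := C0 t (mem_set Ut).
apply: cvg_trans (cvg_comp _ _ h (chart_inv_cvg ct)).
apply: near_eq_cvg; near=> x => /=.
rewrite chart_mapK_dom//; apply: sU; exists x => //.
by near: x; exact: (open_nbhs_nbhs (conj oU Ut)).
Unshelve. all: by end_near. Qed.

(** By the chain rule the velocity changes by the derivative of the transition map, which is what
    [gram_compat] compensates. *)
Lemma chart_speed_change c c' (sigma : R -> M) (t : R) : atlas S c -> atlas S c' ->
  sigma x @[x --> t] --> sigma t -> chart_dom c (sigma t) ->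
  chart_dom c' (sigma t) -> derivable (c \o sigma) t 1 ->
  derivable (c' \o sigma) t 1 /\ chart_speed c' sigma t = chart_speed c sigma t.
Proof.
move=> Sc Sc' st ct c't dc.
have ox : overlap c c' (c (sigma t)) by exists (sigma t).
have dtau := transition_differentiable Sc Sc' ox.
have dc' : differentiable (c \o sigma) t by exact/derivable1_diffP.
have E : \forall x \near t, (c' \o sigma) x = ((c' \o chart_inv c) \o (c \o sigma)) x.
  have n : \forall x \near t, chart_dom c (sigma x) by exact: (st _ (near_chart_dom ct)).
  by apply: filterS n => x cx /=; rewrite chart_mapK_dom.
have E' : \forall x \near t, ((c' \o chart_inv c) \o (c \o sigma)) x = (c' \o sigma) x.
  by apply: filterS E => x ->.
have dcomp : differentiable ((c' \o chart_inv c) \o (c \o sigma)) t.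
  exact: differentiable_comp.
split.
  by apply: near_eq_derivable E' _; exact/derivable1_diffP.
rewrite /chart_speed.
have -> : derive1 (c' \o sigma) t = 'D_(derive1 (c \o sigma) t) (c' \o chart_inv c) (c (sigma t)).
  rewrite [RHS]deriveE// !derive1E (near_eq_derive _ E) [LHS]deriveE// diff_comp//=.
  by rewrite [in RHS]deriveE.
set v := derive1 (c \o sigma) t.
have E'' : (c' \o chart_inv c) (c (sigma t)) = c' (sigma t).
  by rewrite /= chart_mapK_dom.
have H : bilin (gram g c (c (sigma t))) v v =
    bilin (gram g c' ((c' \o chart_inv c) (c (sigma t))))
      ('D_v (c' \o chart_inv c) (c (sigma t))) ('D_v (c' \o chart_inv c) (c (sigma t))).
  exact: (gram_compat g v v Sc Sc' ox).
by rewrite E'' in H; rewrite H.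
Qed.

Lemma speed_chart sigma t c : C1_curve_at S sigma t -> atlas S c ->
  chart_dom c (sigma t) ->
  derivable (c \o sigma) t 1 /\ speed g sigma t = chart_speed c sigma t.
Proof.
move=> st; have [c0 [U [Sc0 oU Ut sU [_ C1]]]] := st.
have ct : chart_dom c0 (sigma t) by apply: sU; exists t.
have cst := C1_curve_cvg st.
have [/(_ t Ut) d0 _] := C1 1.
move=> Sc cct; have [d1 e1] := chart_speed_change Sc0 Sc cst ct cct d0.
split; first exact: d1.
rewrite e1.
exact: (chart_speed_change Sc0 (chart_at_atlas S (sigma t)) cst ct
   (chart_at_dom S (sigma t)) d0).2.
Qed.

Lemma near_C1_curve sigma t : C1_curve_at S sigma t ->
  \forall x \near t, C1_curve_at S sigma x.
Proof.
move=> [c [U [Sc oU Ut sU CU]]].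
by apply: filterS (open_nbhs_nbhs (conj oU Ut)) => x Ux; exists c, U.
Qed.

Lemma speed_cvg sigma t : C1_curve_at S sigma t ->
  speed g sigma x @[x --> t] --> speed g sigma t.
Proof.
move=> st; have [c [U [Sc oU Ut sU [C0 C1]]]] := st.
have nU : \forall x \near t, U x by exact: open_nbhs_nbhs.
have E x : U x -> speed g sigma x = chart_speed c sigma x.
  move=> Ux; apply: (speed_chart _ Sc _).2; last by apply: sU; exists x.
  by exists c, U.
rewrite E//; apply: cvg_trans.
  apply: near_eq_cvg; near=> x; symmetry; apply: E; near: x; exact: nU.
have cc := C0 t (mem_set Ut).
have [_ [C2 _]] := C1 1.
have D : derive1 (c \o sigma) x @[x --> t] --> derive1 (c \o sigma) t.
  have -> : derive1 (c \o sigma) = 'D_1 (c \o sigma).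
    by apply/funext => x; exact: derive1E.
  exact: C2 t (mem_set Ut).
apply: cvg_comp; last exact: sqrt_continuous.
apply: bilin_cvg => //.
apply: (cvg_comp _ _ cc).
by apply: (gram_smooth g Sc 0).1; apply: mem_set; exists (sigma t) => //; apply: sU; exists t.
Unshelve. all: by end_near. Qed.

Lemma speed_ge0 gamma t : 0 <= speed g gamma t.
Proof. exact: sqrtr_ge0. Qed.

Lemma speed_near (gamma sigma : R -> M) t : {near t, gamma =1 sigma} ->
  speed g gamma t = speed g sigma t.
Proof.
move=> E; have Et : gamma t = sigma t := nbhs_singleton E.
rewrite /speed Et.
suff -> : derive1 (chart_at S (sigma t) \o gamma) t = derive1 (chart_at S (sigma t) \o sigma) t by [].
rewrite !derive1E; apply: near_eq_derive.
by apply: filterS E => x /= ->.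
Qed.

End curves.

(** * Length of curves and chains of arcs *)

Lemma is_derive_affine (R : realType) (k b t : R) :
  is_derive t (1 : R) (fun x : R => k * x + b) k.
Proof.
have h1 : is_derive t (1:R) (fun x : R => k * x) (k *: 1) by apply: is_deriveZ.
have h2 := is_deriveD h1 (is_derive_cst b t 1).
by apply: (is_derive_eq h2); rewrite addr0 [_ *: _]mulr1.
Qed.

Lemma derive1_affine (R : realType) (V : normedModType R) (f : R -> V) (k b t : R) :
  derivable f (k * t + b) 1 ->
  derivable (fun x => f (k * x + b)) t 1 /\
  derive1 (fun x => f (k * x + b)) t = k *: derive1 f (k * t + b).
Proof.
move=> df; pose h (x : R) := k * x + b.
have dh : is_derive t (1 : R) h k by exact: is_derive_affine.
have [dh1 dh2] := dh.
have dfd : differentiable f (h t) by exact/derivable1_diffP.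
have dhd : differentiable h t by exact/derivable1_diffP.
have dc : differentiable (f \o h) t by exact: differentiable_comp.
split; first exact/derivable1_diffP.
have e1 : 'd h t 1 = k by rewrite -deriveE.
rewrite -[LHS]/(derive1 (f \o h) t) derive1E deriveE// diff_comp//= e1 derive1E'//.
by rewrite -linearZ/= [_ *: _]mulr1.
Qed.

(** On the line every directional derivative is a multiple of [derive1]. *)
Lemma Ck_on1_real (R : realType) (V : normedModType R) (U : set R) (f : R -> V) :
  open U -> (forall x, U x -> derivable f x 1) ->
  (forall x, U x -> derive1 f y @[y --> x] --> derive1 f x) -> Ck_on 1 U f.
Proof.
move=> oU df cf; split.
  by move=> x /set_mem Ux; apply: differentiable_continuous; exact/derivable1_diffP/df.
move=> v; have E x : U x -> 'D_v f x = v *: derive1 f x.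
  move=> Ux; have dfx : differentiable f x by exact/derivable1_diffP/df.
  by rewrite deriveE// derive1E'// -linearZ/= [_ *: _]mulr1.
split.
  by move=> x Ux; apply: diff_derivable; exact/derivable1_diffP/df.
split=> // x /set_mem Ux; rewrite /continuous_at E//.
have nU : \forall y \near x, U y by exact: (open_nbhs_nbhs (conj oU Ux)).
apply: (@cvg_trans _ ((fun y => v *: derive1 f y) @ x)).
  by apply: near_eq_cvg; apply: filterS nU => y Uy; rewrite E.
have cv : v @[y --> x] --> v by exact: cvg_cst.
exact: (cvgZ cv (cf x Ux)).
Qed.

Section curve_measure.
Variables (R : realType) (m : nat) (M : topologicalType).
Variables (S : smooth_manifold R m M) (g : riemannian_metric S).
Notation mu := (@lebesgue_measure R).

Lemma C1_curve_affine (sigma : R -> M) (k b t : R) :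
  C1_curve_at S sigma (k * t + b) ->
  C1_curve_at S (fun x => sigma (k * x + b)) t /\
  speed g (fun x => sigma (k * x + b)) t = `|k| * speed g sigma (k * t + b).
Proof.
move=> st; have [c [U [Sc oU Ut sU [C0 C1]]]] := st.
have [d1 [c1 _]] := C1 1.
have hc : continuous (fun x : R => k * x + b).
  by move=> x; apply: cvgD; [exact: cvgMr|exact: cvg_cst].
have C1' : C1_curve_at S (fun x => sigma (k * x + b)) t.
  exists c, ((fun x => k * x + b) @^-1` U); split; [exact: Sc| |exact: Ut| |].
  - by apply: open_comp => // x _; exact: hc.
  - by move=> _ [x Ux <-]; apply: sU; exists (k * x + b).
  - apply: Ck_on1_real.
    + by apply: open_comp => // x _; exact: hc.
    + by move=> x Ux; have [] := derive1_affine (d1 _ Ux).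
    + move=> x Ux; have [_ E] := derive1_affine (d1 _ Ux).
      rewrite [X in _ --> X]E.
      have nU : \forall y \near x, U (k * y + b).
        exact: (hc x _ (open_nbhs_nbhs (conj oU Ux))).
      apply: (@cvg_trans _ ((fun y => k *: derive1 (c \o sigma) (k * y + b)) @ x)).
        apply: near_eq_cvg; apply: filterS nU => y Uy.
        exact/esym/(derive1_affine (d1 _ Uy)).2.
      have ck : k @[y --> x] --> k by exact: cvg_cst.
      have cd : derive1 (c \o sigma) (k * y + b) @[y --> x] -->
                derive1 (c \o sigma) (k * x + b).
        apply: (@cvg_comp _ _ _ (fun y : R => k * y + b) (derive1 (c \o sigma)) _ (nbhs (k * x + b))).
          exact: hc.
        rewrite (_ : derive1 _ = 'D_1 (c \o sigma)); last by apply/funext => y; rewrite derive1E.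
        by apply: c1; exact: mem_set.
      exact: (cvgZ ck cd).
split=> //.
have ct : chart_dom c (sigma (k * t + b)) by apply: sU; exists (k * t + b).
have [_ ->] := speed_chart g C1' Sc ct.
have [ds ->] := speed_chart g st Sc ct.
rewrite /chart_speed; have [_ ->] := derive1_affine ds.
rewrite [X in Num.sqrt X](_ : _ = k ^+ 2 * bilin (gram g c (c (sigma (k * t + b))))
  (derive1 (c \o sigma) (k * t + b)) (derive1 (c \o sigma) (k * t + b))).
  by rewrite sqrtrM ?sqr_ge0// sqrtr_sqr.
by rewrite /bilin linearZ/= -!scalemxAl -scalemxAr scalerA !mxE expr2.
Qed.

Definition C1_on (sigma : R -> M) (al be : R) :=
  forall t, al <= t <= be -> C1_curve_at S sigma t.

Definition plen (sigma : R -> M) (al be : R) : R :=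
  \int[mu]_(t in `[al, be]) speed g sigma t.

Lemma C1_on_sub sigma al be al' be' : C1_on sigma al be -> al <= al' -> be' <= be ->
  C1_on sigma al' be'.
Proof.
move=> C h1 h2 t /andP[t1 t2]; apply: C.
by rewrite (le_trans h1 t1) (le_trans t2 h2).
Qed.

Lemma speed_within_continuous sigma al be : C1_on sigma al be ->
  {within `[al, be], continuous (speed g sigma)}.
Proof.
move=> C; apply/continuous_in_subspaceT => t /set_mem /=; rewrite in_itv/= => tab.
exact: speed_cvg (C _ tab).
Qed.

Lemma speed_integrable sigma al be : C1_on sigma al be ->
  mu.-integrable `[al, be] (EFin \o speed g sigma).
Proof.
move=> C; apply: continuous_compact_integrable; first exact: segment_compact.
exact: speed_within_continuous.
Qed.

Lemma speed_measurable sigma al be : C1_on sigma al be ->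
  measurable_fun `[al, be] (speed g sigma).
Proof.
move=> /speed_integrable /integrableP[+ _].
by move=> /measurable_EFinP.
Qed.

Lemma plenE sigma al be : C1_on sigma al be ->
  (\int[mu]_(t in `[al, be]) (speed g sigma t)%:E = (plen sigma al be)%:E)%E.
Proof.
move=> C; rewrite /plen /Rintegral fineK//.
by apply: integrable_fin_num => //; exact: speed_integrable.
Qed.

Lemma plen_ge0 sigma al be : 0 <= plen sigma al be.
Proof. by apply: Rintegral_ge0 => t _; exact: speed_ge0. Qed.

Lemma plen_point sigma al : plen sigma al al = 0.
Proof. by rewrite /plen set_itv1 Rintegral_set1. Qed.

Lemma plen_split sigma al t be : C1_on sigma al be -> al <= t -> t <= be ->
  plen sigma al be = plen sigma al t + plen sigma t be.
Proof.
move=> C h1 h2; apply/eqP; rewrite addrC -subr_eq /plen.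
rewrite Rintegral_itvB//; last exact: speed_integrable.
apply/eqP; apply: Rintegral_itv_obnd_cbnd.
apply: integrableS (speed_integrable C) => //.
by apply: subset_itvr; rewrite bnd_simp.
Qed.

Lemma plen_le sigma al be K : al <= be -> C1_on sigma al be ->
  (forall t, al <= t <= be -> speed g sigma t <= K) -> plen sigma al be <= K * (be - al).
Proof.
move=> ab C sK; apply: (@le_trans _ _ (\int[mu]_(t in `[al, be]) (cst K) t)).
  have icst : mu.-integrable `[al, be] (EFin \o cst K).
    apply: continuous_compact_integrable; first exact: segment_compact.
    by apply: continuous_subspaceT; exact: cst_continuous.
  exact: (le_Rintegral _ (speed_integrable C) icst).
rewrite Rintegral_cst//. have E := lebesgue_measure_itv `[al, be]. rewrite [X in fine X](_ : _ = if al < be then (be - al)%:E else 0%E); last by rewrite -[LHS]/(lebesgue_measure `[al, be]%classic) E/= lte_fin.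
by case: ltgtP ab => //= -> _; rewrite subrr mulr0.
Qed.

Lemma plen_affine sigma k b al be : 0 < k -> al <= be ->
  C1_on sigma (k * al + b) (k * be + b) ->
  plen (fun x => sigma (k * x + b)) al be = plen sigma (k * al + b) (k * be + b).
Proof.
move=> k0 ab C; rewrite /plen /Rintegral; apply: (congr1 fine).
have dF t : is_derive t (1 : R) (fun x => k * x + b) k by exact: is_derive_affine.
have E : derive1 (fun x : R => k * x + b) = cst k.
  by apply/funext => t; rewrite derive1E; have [_ ->] := dF t.
have Fc : continuous (fun x : R => k * x + b).
  by move=> x; apply: cvgD; [exact: cvgMr|exact: cvg_cst].
pose F (x : R) := k * x + b.
have dFo : derivable_oo_LRcontinuous F al be.
  split; first by move=> t _; have [] := dF t.
    exact/cvg_at_right_filter/Fc.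
  exact/cvg_at_left_filter/Fc.
have Fi : {in `[al, be] &, {homo F : x y / x < y}}.
  by move=> x y _ _ xy; rewrite ltrD2r ltr_pM2l.
have cG : {within `[F al, F be], continuous (speed g sigma)}.
  exact: speed_within_continuous.
have := @integration_by_substitution_increasing R F (speed g sigma) al be ab Fi.
rewrite E => /(_ _ _ _ dFo cG) ->.
- apply: eq_integral => t /set_mem /=; rewrite in_itv/= => /andP[t1 t2].
  congr EFin; rewrite /= /GRing.mul_fun/=.
  have h : k * al + b <= k * t + b <= k * be + b by rewrite !lerD2r !ler_pM2l// t1 t2.
  have [_ ->] := C1_curve_affine (C _ h).
  by rewrite gtr0_norm// mulrC.
- by move=> t _; exact: cst_continuous.
- exact: is_cvg_cst.
- exact: is_cvg_cst.
Qed.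

(** Reversal is separate from [plen_affine], whose substitution is increasing; it yields the
    symmetry of the distance. *)
Lemma plen_opp sigma al be : al <= be -> C1_on sigma al be ->
  C1_on (sigma \o -%R) (- be) (- al) /\
  plen (sigma \o -%R) (- be) (- al) = plen sigma al be.
Proof.
move=> ab C.
have Eo : (sigma \o -%R) = (fun x => sigma (-1 * x + 0)).
  by apply/funext => x /=; rewrite addr0 mulN1r.
have D t : - be <= t <= - al -> C1_curve_at S (sigma \o -%R) t /\
    speed g (sigma \o -%R) t = speed g sigma (- t).
  move=> /andP[t1 t2]; rewrite Eo.
  have h : C1_curve_at S sigma (-1 * t + 0).
    by apply: C; rewrite addr0 mulN1r lerNr t2 lerNl t1.
  have [h1 ->] := C1_curve_affine h.
  by rewrite normrN1 mul1r addr0 mulN1r.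
split; first by move=> t /D[].
rewrite /plen /Rintegral; apply: (congr1 fine).
transitivity (\int[mu]_(x in `[(- be)%R, (- al)%R]) ((speed g sigma \o -%R) x)%:E)%E.
  apply: eq_integral => t /set_mem /=; rewrite in_itv/= => /D[_ ->] //.
rewrite -integration_by_substitution_oppr ?lerN2 ?opprK//.
exact: speed_within_continuous.
Qed.

(** Measurability is carried along because a glued curve need not be C^1 at its junctions, and
    adding integrals over adjacent intervals requires it. *)
Definition has_length (gamma : R -> M) (al be l : R) :=
  measurable_fun `[al, be] (speed g gamma) /\
  (\int[mu]_(t in `[al, be]) (speed g gamma t)%:E = l%:E)%E.

(** At the end points [gamma] may continue differently, so its speed is uncontrolled there; the
    speeds agree in the interior, and the end points are negligible. *)
Lemma has_length_ext gamma gamma' al be l : al < be ->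
  (forall t, al <= t <= be -> gamma t = gamma' t) ->
  has_length gamma' al be l -> has_length gamma al be l.
Proof.
move=> ab E [ms il].
have Es t : t \in `]al, be[ -> speed g gamma t = speed g gamma' t.
  rewrite in_itv/= => /andP[t1 t2]; apply: speed_near.
  near=> x; apply: E; apply/andP; split; apply: ltW.
    by near: x; exact: lt_nbhsr.
  by near: x; exact: lt_nbhsl.
have ms' : measurable_fun `]al, be[ (speed g gamma').
  by apply: measurable_funS ms => //; exact: subset_itv_oo_cc.
have mg : measurable_fun `]al, be[ (speed g gamma).
  have Es' : {in `]al, be[%classic, speed g gamma' =1 speed g gamma}.
    by move=> t /set_mem tab; rewrite Es.
  exact: (@eq_measurable_fun _ _ _ _ _ (speed g gamma') (speed g gamma) Es' ms').
split.
  apply/measurable_fun_itv_bndo_bndcP.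
  by apply/measurable_fun_itv_obnd_cbndP.
rewrite -il.
exact: (@eq_integral_itv_bounded R al be (speed g gamma') (speed g gamma) true false mg ms' Es).
Unshelve. all: by end_near. Qed.

Lemma has_length_C1 sigma al be : C1_on sigma al be ->
  has_length sigma al be (plen sigma al be).
Proof. by move=> C; split; [exact: speed_measurable|exact: plenE]. Qed.

Lemma has_length_cat gamma al t be l l' : al <= t -> t <= be ->
  has_length gamma al t l -> has_length gamma t be l' -> has_length gamma al be (l + l').
Proof.
move=> h1 h2 [m1 i1] [m2 i2].
have E : `[al, be]%classic = `[al, t]%classic `|` `]t, be]%classic.
  by apply: itv_bndbnd_setU; rewrite bnd_simp.
have m2' : measurable_fun `]t, be] (speed g gamma) by exact/measurable_fun_itv_obnd_cbndP.
have mm : measurable_fun `[al, be] (speed g gamma) by rewrite E; exact/measurable_funU.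
split=> //.
rewrite E integral_setU//=; last 2 first.
- by rewrite -E; exact/measurable_EFinP.
- rewrite disj_set2E; apply/eqP/seteqP; split=> // x [] /=; rewrite !in_itv/=.
  by move=> /andP[_ xt] /andP[tx _]; move: (lt_le_trans tx xt); rewrite ltxx.
rewrite i1 integral_itv_obnd_cbnd; first by rewrite i2.
exact/measurable_EFinP.
Qed.

(* Arcs keep their own parameter intervals, so cutting a chain needs no
   reparametrization. *)
Inductive chain : M -> M -> R -> Prop :=
| chain_nil p : chain p p 0
| chain_cons sigma al be q l : al <= be -> C1_on sigma al be ->
    chain (sigma be) q l -> chain (sigma al) q (plen sigma al be + l).

Lemma chain_ge0 p q l : chain p q l -> 0 <= l.
Proof. by elim=> // sigma al be q' l' _ _ _ l0; rewrite addr_ge0// plen_ge0. Qed.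

Lemma chain_piece sigma al be : al <= be -> C1_on sigma al be ->
  chain (sigma al) (sigma be) (plen sigma al be).
Proof.
move=> ab C; rewrite -[plen _ _ _]addr0; apply: chain_cons => //; exact: chain_nil.
Qed.

Lemma chain_cat p q r l l' : chain p q l -> chain q r l' -> chain p r (l + l').
Proof.
move=> h; elim: h r l' => [p' r l'|sigma al be q' l1 ab C _ IH r l' qr].
  by rewrite add0r.
by rewrite -addrA; apply: chain_cons => //; exact: IH.
Qed.

Lemma chain_sym p q l : chain p q l -> chain q p l.
Proof.
elim=> [p'|sigma al be q' l1 ab C _ IH]; first exact: chain_nil.
rewrite addrC; apply: chain_cat IH _.
have [C' <-] := plen_opp ab C.
have := chain_piece _ C'; rewrite /= !opprK; apply.
by rewrite lerN2.
Qed.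
End curve_measure.

(** * The distance as an infimum over chains *)

Section rdist_chain.
Variables (R : realType) (m : nat) (M : topologicalType).
Variables (S : smooth_manifold R m M) (g : riemannian_metric S).

Lemma piecewise_chain (gamma : R -> M) : piecewise_C1 S gamma ->
  exists2 l, chain g (gamma 0) (gamma 1) l & curve_length g gamma = l%:E.
Proof.
move=> [n [t [t0 tn tP]]].
suff H k : (k <= n)%N -> exists l, [/\ t 0%N <= t k, chain g (gamma (t 0%N)) (gamma (t k)) l &
    has_length g gamma (t 0%N) (t k) l].
  have [l [_ cl [_ il]]] := H n (leqnn n).
  by exists l; [move: cl; rewrite t0 tn|move: il; rewrite t0 tn].
elim: k => [_|k IH kn].
  exists 0; split=> //; first exact: chain_nil.
  by rewrite /has_length set_itv1 integral_set1; split=> //; exact: measurable_fun_set1.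
have [l [t0k cl hl]] := IH (ltnW kn).
have [tk [sigma sP]] := tP _ kn.
have C : C1_on S sigma (t k) (t k.+1) by move=> x /sP[].
have E x : t k <= x <= t k.+1 -> gamma x = sigma x by move=> /sP[].
exists (l + plen g sigma (t k) (t k.+1)); split.
- exact: le_trans t0k (ltW tk).
- apply: chain_cat cl _; rewrite !E ?lexx ?(ltW tk)//.
  exact: chain_piece (ltW tk) C.
- apply: has_length_cat hl _ => //; first exact: ltW.
  by apply: has_length_ext tk E _; exact: has_length_C1.
Qed.

(** [piecewise_C1] on an arbitrary interval, so that the arcs of a chain can be laid out by
    induction. *)
Definition pieces (gamma : R -> M) (al be : R) : Prop :=
  exists (n : nat) (t : nat -> R),
    [/\ t 0%N = al, t n = be &
        forall i, (i < n)%N -> t i < t i.+1 /\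
          exists sigma : R -> M, forall x, t i <= x <= t i.+1 ->
            C1_curve_at S sigma x /\ gamma x = sigma x].

Lemma pieces_ge (gamma : R -> M) (n : nat) (t : nat -> R) :
  (forall i, (i < n)%N -> t i < t i.+1) -> forall i, (i <= n)%N -> t 0%N <= t i.
Proof.
move=> h; elim=> // i IH le_in.
by apply: le_trans (IH (ltnW le_in)) (ltW (h _ le_in)).
Qed.

Lemma C1_curve_cst (p : M) t : C1_curve_at S (cst p) t.
Proof.
exists (chart_at S p), setT; split => //.
- exact: chart_at_atlas.
- exact: openT.
- by move=> _ [x _ <-]; exact: chart_at_dom.
- have E : chart_at S p \o cst p = cst (chart_at S p p) by [].
  rewrite E; apply: Ck_on1_real; first exact: openT.
    by move=> x _; exact: derivable_cst.
  move=> x _; have -> : derive1 (cst (chart_at S p p)) = cst (0 : 'rV[R]_m).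
    by apply/funext => y; exact: derive1_cst.
  exact: cvg_cst.
Qed.

Lemma speed_cst (p : M) t : speed g (cst p) t = 0.
Proof.
have E : chart_at S p \o cst p = cst (chart_at S p p) by [].
by rewrite /speed E derive1_cst /bilin linear0 mulmx0 mxE sqrtr0.
Qed.

(** Quantifying over the interval makes the induction work: the first arc is rescaled to the left
    half, the rest goes to the right half. Arcs with [a = b] are dropped, since the subdivision of a
    piecewise curve is strict, and the empty chain becomes a constant curve. *)
Lemma chain_curve p q l : chain g p q l -> forall al be, al < be ->
  exists gamma, [/\ pieces gamma al be, gamma al = p, gamma be = q &
    has_length g gamma al be l].
Proof.
elim=> {p q l} [p|sigma a b q l ab C _ IH] al be albe.
  exists (cst p); split=> //.
    exists 1%N, (fun i => if i is 0%N then al else be); split=> // -[|//] _.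
    by split=> //; exists (cst p) => x _; split=> //; exact: C1_curve_cst.
  have C : C1_on S (cst p) al be by move=> t _; exact: C1_curve_cst.
  suff <- : plen g (cst p) al be = 0 by exact: has_length_C1.
  apply/eqP; rewrite eq_le plen_ge0 andbT.
  have := @plen_le _ _ _ _ g (cst p) al be 0 (ltW albe) C.
  by rewrite mul0r; apply => t _; rewrite speed_cst.
have [eab|nab] := eqVneq a b.
  have [gamma [h1 h2 h3 h4]] := IH _ _ albe.
  by exists gamma; rewrite eab plen_point add0r.
have {nab}ab' : a < b by rewrite lt_neqAle nab.
pose mid := (al + be) / 2.
have [alm mbe] : al < mid /\ mid < be by rewrite /mid; split; lra.
have [gamma' [[n [t [t0 tn tP]]] g1 g2 g3]] := IH _ _ mbe.
pose k := (b - a) / (mid - al); pose c := a - k * al.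
have k0 : 0 < k by rewrite divr_gt0 // subr_gt0.
have ka : k * al + c = a by rewrite /c addrC subrK.
have kb : k * mid + c = b.
  rewrite /c addrCA -mulrBr /k divfK; last by rewrite gt_eqF// subr_gt0.
  by rewrite addrC subrK.
pose sigma' x := sigma (k * x + c).
have C' : C1_on S sigma' al mid.
  move=> x /andP[x1 x2]; apply: (C1_curve_affine g _).1; apply: C.
  by rewrite -ka -kb !lerD2r !ler_pM2l// x1 x2.
pose gamma x := if x <= mid then sigma' x else gamma' x.
have gs x : al <= x <= mid -> gamma x = sigma' x by rewrite /gamma => /andP[_ ->].
have gg x : mid <= x <= be -> gamma x = gamma' x.
  rewrite /gamma => /andP[mx _]; case: ifPn => // xm.
  have -> : x = mid by apply: le_anti; rewrite mx xm.
  by rewrite g1 /sigma' kb.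
have tge : forall i, (i <= n)%N -> mid <= t i.
  by rewrite -t0; apply: pieces_ge => // i /tP[].
have tle : forall i, (i <= n)%N -> t i <= be.
  move=> i le_in; rewrite -tn.
  have := @pieces_ge (cst (gamma al)) (n - i)%N (fun j => t (i + j)%N) _ (n - i)%N (leqnn _).
  rewrite addn0 subnKC//; apply => j jn; rewrite addnS.
  by apply: (tP _ _).1; rewrite -ltn_subRL.
exists gamma; split.
- exists n.+1, (fun i => if i is i'.+1 then t i' else al); split=> // -[_|i].
    rewrite t0; split=> //; exists sigma' => x xm.
    by split; [exact: C'|exact: gs].
  rewrite ltnS => le_in; have [ti [s sP]] := tP _ le_in; split=> //.
  exists s => x xi; have [h1 h2] := sP _ xi; split=> //.
  move: xi => /andP[x1 x2]; rewrite gg// (le_trans (tge _ (ltnW le_in)) x1).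
  by rewrite (le_trans x2 (tle _ le_in)).
- by rewrite gs ?lexx ?ltW// /sigma' ka.
- by rewrite gg ?lexx ?ltW.
- have P : plen g sigma' al mid = plen g sigma a b.
    by rewrite /sigma' plen_affine ?ka ?kb// ltW.
  apply: (@has_length_cat _ _ _ _ _ _ _ mid); [exact: ltW|exact: ltW| |].
    by apply: has_length_ext alm gs _; rewrite -P; exact: has_length_C1.
  exact: has_length_ext mbe gg g3.
Qed.

Lemma curve_set_chain p q :
  [set curve_length g gamma | gamma in
    [set gamma | piecewise_C1 S gamma /\ gamma 0 = p /\ gamma 1 = q]] =
  [set l%:E | l in chain g p q].
Proof.
apply/seteqP; split => [_ [gamma [pw [<- <-]]] <-|_ [l cl] <-].
  by have [l cl ->] := piecewise_chain pw; exists l.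
have [gamma [h1 h2 h3 [_ h4]]] := chain_curve cl ltr01.
by exists gamma.
Qed.

Lemma rdistE p q : rdist g p q = fine (ereal_inf [set l%:E | l in chain g p q]).
Proof. by rewrite /rdist curve_set_chain. Qed.

Let chain_inf_fin p q l : chain g p q l ->
  ereal_inf [set l%:E | l in chain g p q] \is a fin_num.
Proof.
move=> cl; rewrite ge0_fin_numE.
  by apply: le_lt_trans (ltry l); apply: ereal_inf_lbound; exists l.
by apply: le_ereal_inf_tmp => _ [k ck <-]; rewrite lee_fin (chain_ge0 ck).
Qed.

Lemma rdist_le_chain p q l : chain g p q l -> rdist g p q <= l.
Proof.
move=> cl; rewrite rdistE -lee_fin fineK; last exact: chain_inf_fin cl.
by apply: ereal_inf_lbound; exists l.
Qed.

Lemma rdist_chain p q l0 e : chain g p q l0 -> 0 < e ->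
  exists2 l, chain g p q l & l < rdist g p q + e.
Proof.
move=> cl e0; have fin := chain_inf_fin cl.
have [_ [l cl' <-] le] := lb_ereal_inf_adherent e0 fin.
by exists l => //; rewrite rdistE -lte_fin EFinD fineK.
Qed.

Lemma rdist_ge0 p q : 0 <= rdist g p q.
Proof.
rewrite rdistE fine_ge0//.
by apply: le_ereal_inf_tmp => _ [k ck <-]; rewrite lee_fin (chain_ge0 ck).
Qed.

End rdist_chain.

(** * Inner products, orthonormal bases and the regular simplex *)

Section bilin.
Variables (R : realType) (m : nat) (G : 'M[R]_m).

Lemma bilinDl u v w : bilin G (u + v) w = bilin G u w + bilin G v w.
Proof. by rewrite /bilin !mulmxDl mxE. Qed.

Lemma bilinDr u v w : bilin G u (v + w) = bilin G u v + bilin G u w.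
Proof. by rewrite /bilin linearD/= mulmxDr mxE. Qed.

Lemma bilinZl k u v : bilin G (k *: u) v = k * bilin G u v.
Proof. by rewrite /bilin -!scalemxAl mxE. Qed.

Lemma bilinZr k u v : bilin G u (k *: v) = k * bilin G u v.
Proof. by rewrite /bilin linearZ/= -scalemxAr mxE. Qed.

Lemma bilinNl u v : bilin G (- u) v = - bilin G u v.
Proof. by rewrite -scaleN1r bilinZl mulN1r. Qed.

Lemma bilinNr u v : bilin G u (- v) = - bilin G u v.
Proof. by rewrite -scaleN1r bilinZr mulN1r. Qed.

Lemma bilin0l v : bilin G 0 v = 0.
Proof. by rewrite /bilin !mul0mx mxE. Qed.

Lemma bilin_sumr I (r : seq I) (u : 'rV[R]_m) (f : I -> 'rV[R]_m) :
  bilin G u (\sum_(i <- r) f i) = \sum_(i <- r) bilin G u (f i).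
Proof.
elim/big_rec2: _ => [|i x y _ <-]; last by rewrite bilinDr.
by rewrite /bilin linear0 mulmx0 mxE.
Qed.

Definition gnorm (u : 'rV[R]_m) : R := Num.sqrt (bilin G u u).

Lemma gnorm_ge0 u : 0 <= gnorm u. Proof. exact: sqrtr_ge0. Qed.

Lemma gnorm0 : gnorm 0 = 0. Proof. by rewrite /gnorm bilin0l sqrtr0. Qed.

Hypothesis Gsym : G^T = G.
Hypothesis Gpos : forall u : 'rV[R]_m, u != 0 -> 0 < bilin G u u.

Lemma bilinC u v : bilin G u v = bilin G v u.
Proof.
have E : v *m G *m u^T = (u *m G *m v^T)^T by rewrite !trmx_mul trmxK Gsym mulmxA.
by rewrite /bilin E [RHS]mxE.
Qed.

Lemma bilin_ge0 u : 0 <= bilin G u u.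
Proof. by have [->|/Gpos/ltW//] := eqVneq u 0; rewrite bilin0l. Qed.

Lemma gnorm_sqr u : gnorm u ^+ 2 = bilin G u u.
Proof. by rewrite sqr_sqrtr// bilin_ge0. Qed.

Lemma gnorm_gt0 u : u != 0 -> 0 < gnorm u.
Proof. by move=> /Gpos; rewrite sqrtr_gt0. Qed.

Lemma gnormZ k u : gnorm (k *: u) = `|k| * gnorm u.
Proof.
rewrite /gnorm bilinZl bilinZr mulrA -expr2 sqrtrM ?sqr_ge0//.
by rewrite sqrtr_sqr.
Qed.

Lemma gnormN u : gnorm (- u) = gnorm u.
Proof. by rewrite -scaleN1r gnormZ normrN1 mul1r. Qed.

Lemma gnormB u v : gnorm (u - v) = gnorm (v - u).
Proof. by rewrite -gnormN opprB. Qed.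

Lemma cauchy_schwarz u v : bilin G u v <= gnorm u * gnorm v.
Proof.
have [->|v0] := eqVneq v 0.
  by rewrite bilinC bilin0l gnorm0 mulr0.
have [->|u0] := eqVneq u 0; first by rewrite bilin0l gnorm0 mul0r.
have nv := gnorm_gt0 v0; have nu := gnorm_gt0 u0.
have p : 0 < gnorm u * gnorm v by rewrite mulr_gt0.
rewrite -(ler_pM2l p).
have := bilin_ge0 (gnorm v *: u - gnorm u *: v).
rewrite bilinDl !bilinDr !bilinNl !bilinNr !bilinZl !bilinZr -!gnorm_sqr (bilinC v u).
lra.
Qed.

Lemma gnormD u v : gnorm (u + v) <= gnorm u + gnorm v.
Proof.
rewrite -(ler_pXn2r (n := 2))// ?nnegrE ?addr_ge0 ?gnorm_ge0//.
rewrite sqrrD !gnorm_sqr bilinDl !bilinDr (bilinC v u).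
have := cauchy_schwarz u v; lra.
Qed.

Lemma parallelogram u v :
  gnorm (u + v) ^+ 2 + gnorm (u - v) ^+ 2 = 2 * gnorm u ^+ 2 + 2 * gnorm v ^+ 2.
Proof.
by rewrite !gnorm_sqr !(bilinDl, bilinDr, bilinNl, bilinNr) (bilinC v u); ring.
Qed.

Lemma gnorm_cvg (T : Type) (F : set_system T) {FF : Filter F}
    (f : T -> 'rV[R]_m) (u : 'rV[R]_m) :
  f x @[x --> F] --> u -> gnorm (f x) @[x --> F] --> gnorm u.
Proof.
move=> fu; apply: (@cvg_comp _ _ _ (fun x => bilin G (f x) (f x)) Num.sqrt _ (nbhs (bilin G u u))).
  by apply: bilin_cvg => //; exact: cvg_cst.
exact: sqrt_continuous.
Qed.

End bilin.

(* Induction on the size, through the Schur complement [D'] of the top left entry. *)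
Lemma cholesky (R : realType) (m : nat) (G : 'M[R]_m) : G^T = G ->
  (forall u : 'rV[R]_m, u != 0 -> 0 < bilin G u u) ->
  exists P : 'M[R]_m, P *m G *m P^T = 1%:M.
Proof.
elim: m G => [G _ _|m IH G].
  by exists 0; apply/matrixP => -[].
move: G; rewrite -[m.+1]/(1 + m)%N => G Gs Gp.
pose a := ulsubmx G; pose b := ursubmx G; pose D := drsubmx G.
have Ds : D^T = D by rewrite /D trmx_drsub Gs.
have GE : G = block_mx a b b^T D by rewrite -[LHS]submxK -[in LHS]Gs -trmx_ursub Gs.
rewrite GE in Gp *.
pose al := a 0 0; have aE : a = al%:M by rewrite [LHS]mx11_scalar.
have al0 : 0 < al.
  have := Gp (row_mx 1%:M 0); rewrite /bilin mul_row_block !mul1mx !mul0mx !addr0.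
  rewrite tr_row_mx mul_row_col trmx1 trmx0 mulmx0 mulmx1 addr0; apply.
  by apply/eqP => /matrixP /(_ 0 (lshift m 0)); rewrite row_mxEl !mxE eqxx => /eqP; rewrite oner_eq0.
pose D' := D - al^-1 *: (b^T *m b).
have D's : D'^T = D'.
  by rewrite /D' linearB/= linearZ/= trmx_mul trmxK Ds.
have [v v0|P' P'E] := IH D' D's.
  pose w : 'rV[R]_(1 + m) := row_mx (- al^-1 *: (v *m b^T)) v.
  have w0 : w != 0.
    apply: contra v0 => /eqP w0; apply/eqP.
    by have := congr1 rsubmx w0; rewrite /w row_mxKr => ->; rewrite linear0.
  have := Gp w w0; rewrite /bilin /w mul_row_block tr_row_mx mul_row_col aE.
  rewrite mul_mx_scalar scalerA mulrN divff ?gt_eqF// scaleN1r addNr mul0mx add0r.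
  rewrite /D' mulmxBr -scalemxAr -scalemxAl mulmxA addrC.
  by rewrite scaleNr.
exists (block_mx ((Num.sqrt al)^-1)%:M 0 (- al^-1 *: (P' *m b^T)) P').
have sa0 : 0 < Num.sqrt al by rewrite sqrtr_gt0.
have e21 : (- al^-1 *: (P' *m b^T)) *m a + P' *m b^T = 0.
  by rewrite aE mul_mx_scalar scalerA mulrN divff ?gt_eqF// scaleN1r addNr.
have e22 : (- al^-1 *: (P' *m b^T)) *m b + P' *m D = P' *m D'.
  by rewrite /D' mulmxBr -scalemxAr -scalemxAl mulmxA addrC scaleNr.
have e12 : ((Num.sqrt al)^-1)%:M *m a *m (- al^-1 *: (P' *m b^T))^T +
    ((Num.sqrt al)^-1)%:M *m b *m P'^T = 0.
  rewrite aE -!scalar_mxM !mul_scalar_mx linearZ/= trmx_mul trmxK scalerA mulrN -mulrA.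
  by rewrite divff ?gt_eqF// mulr1 -scalemxAl scaleNr addNr.
rewrite mulmx_block !mul0mx !addr0 e21 e22 tr_block_mx mulmx_block.
rewrite !trmx0 !mul0mx !mulmx0 !addr0 !add0r e12 P'E [RHS](scalar_mx_block 1 m 1%R).
congr block_mx.
rewrite aE tr_scalar_mx -!scalar_mxM; congr (_%:M).
by rewrite -{2}(sqr_sqrtr (ltW al0)) expr2 mulrA mulVf ?gt_eqF// mul1r divff ?gt_eqF.
Qed.

Section simplex.
Variables (R : realType) (m : nat) (G : 'M[R]_m).
Hypothesis Gsym : G^T = G.
Hypothesis Gpos : forall u : 'rV[R]_m, u != 0 -> 0 < bilin G u u.

(** The rows of the Cholesky factor [P] are orthonormal since [P *m G *m P^T = 1]. One-sided
    inverses of square matrices are two-sided, so also [G *m P^T *m P = 1], which is the expansion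
    formula. *)
Lemma ex_orthonormal_basis : exists e : 'I_m -> 'rV[R]_m,
  (forall i j, bilin G (e i) (e j) = (i == j)%:R) /\
  forall u, u = \sum_i bilin G u (e i) *: e i.
Proof.
have [P PE] := cholesky Gsym Gpos.
exists (fun i => row i P); split => [i j|u].
  have := congr1 (fun A : 'M[R]_m => A i j) PE; rewrite [RHS]mxE => <-.
  by rewrite /bilin -row_mul mxE [RHS]mxE; apply: eq_bigr => k _; rewrite !mxE.
have PE' : G *m P^T *m P = 1%:M.
  by apply: mulmx1C; rewrite mulmxA.
have -> : \sum_i bilin G u (row i P) *: row i P = (u *m (G *m P^T)) *m P.
  rewrite mulmx_sum_row; apply: eq_bigr => i _; congr (_ *: _).
  by rewrite /bilin mulmxA mxE [RHS]mxE; apply: eq_bigr => k _; rewrite !mxE.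
by rewrite -mulmxA PE' mulmx1.
Qed.

(** Cauchy-Schwarz bounds the coordinates in an orthonormal basis by [gnorm G u]; the summand [1]
    keeps the constant positive when the basis is empty. *)
Lemma norm_le_gnorm : exists2 C, 0 < C & forall u, `|u| <= C * gnorm G u.
Proof.
have [e [eo ue]] := ex_orthonormal_basis.
exists (1 + \sum_j `|e j|) => [|u].
  by rewrite ltr_pwDl// sumr_ge0.
rewrite mulrDl mul1r {1}[u]ue.
apply: le_trans (ler_norm_sum _ _ _) _; apply: (@le_trans _ _ ((\sum_j `|e j|) * gnorm G u)).
  rewrite mulr_suml; apply: ler_sum => j _; rewrite normrZ mulrC ler_wpM2l//.
  have e1 : gnorm G (e j) = 1 by rewrite /gnorm eo eqxx sqrtr1.
  rewrite ler_norml lerNl -bilinNl; apply/andP; split.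
    by apply: le_trans (cauchy_schwarz Gsym Gpos _ _) _; rewrite gnormN e1 mulr1.
  by apply: le_trans (cauchy_schwarz Gsym Gpos _ _) _; rewrite e1 mulr1.
by rewrite lerDr gnorm_ge0.
Qed.

(* With [one := \sum_i e i] and [k := 1 / sqrt (m + 1)], the vectors
   [e i + (k - 1) / m *: one] and [- k *: one] are the images of the centred
   basis vectors of R^(m+1) under an isometry of the hyperplane of zero sum;
   [s] rescales them to unit length. *)
Lemma regular_simplex : (0 < m)%N -> exists v : option 'I_m -> 'rV[R]_m,
  [/\ \sum_i v i = 0, forall i, gnorm G (v i) = 1 &
      forall i j, i != j -> gnorm G (v i - v j) ^+ 2 = 2 * (m%:R + 1) / m%:R].
Proof.
move=> m0; have [e [eo _]] := ex_orthonormal_basis.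
have mr0 : 0 < m%:R :> R by rewrite ltr0n.
pose one := \sum_i e i.
have e1 i : bilin G (e i) one = 1.
  rewrite /one bilin_sumr (bigD1 i)//= eo eqxx big1 ?addr0// => j ji.
  by rewrite eo eq_sym (negbTE ji).
have oneone : bilin G one one = m%:R.
  rewrite {2}/one bilin_sumr (eq_bigr (fun=> 1)) => [|i _]; last by rewrite bilinC.
  by rewrite sumr_const card_ord.
have ee i : bilin G (e i) (e i) = 1 by rewrite eo eqxx.
pose k := (Num.sqrt (m%:R + 1 : R))^-1.
have m1 : 0 < m%:R + 1 :> R by rewrite ltr_pwDr.
have kE : k ^+ 2 * (m%:R + 1) = 1.
  by rewrite /k exprVn sqr_sqrtr ?ltW// mulVf// gt_eqF.
pose al := (k - 1) / m%:R.
have alE : m%:R * al = k - 1 by rewrite /al mulrC divfK// gt_eqF.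
pose s := Num.sqrt ((m%:R + 1) / m%:R : R).
have sE : s ^+ 2 * m%:R = m%:R + 1.
  by rewrite sqr_sqrtr ?divr_ge0 ?ltW// divfK// gt_eqF.
pose v i := s *: (if i is Some j then e j + al *: one else - k *: one).
have expand a b x y : bilin G (a *: (x + y)) (b *: (x + y)) =
    a * b * (bilin G x x + 2 * bilin G x y + bilin G y y).
  by rewrite bilinZl bilinZr bilinDl !bilinDr (bilinC Gsym y x); ring.
have vv i : bilin G (v i) (v i) = 1.
  case: i => [j|] /=.
    rewrite /v expand ee bilinZr e1 bilinZl bilinZr oneone -expr2.
    (* Multiplying by [m] lets [al] be eliminated through [m * al = k - 1]. *)
    have h : m%:R * (1 + 2 * (al * 1) + al * (al * m%:R)) = m%:R * k ^+ 2 * m%:R.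
      rewrite (_ : m%:R * _ = m%:R + 2 * (m%:R * al) + (m%:R * al) ^+ 2); last by ring.
      rewrite alE; have : k ^+ 2 * m%:R = 1 - k ^+ 2 by move: kE; lra.
      move=> h; rewrite -mulrA h.
      have -> : m%:R * (1 - k ^+ 2) = m%:R - k ^+ 2 * m%:R by ring.
      by rewrite h; ring.
    apply: (mulfI (lt0r_neq0 mr0)); rewrite mulrCA h mulr1.
    have -> : s ^+ 2 * (m%:R * k ^+ 2 * m%:R) = (s ^+ 2 * m%:R) * k ^+ 2 * m%:R by ring.
    by rewrite sE [(_ + 1) * _]mulrC kE mul1r.
  rewrite /v scalerA bilinZl bilinZr oneone.
  have -> : s * - k * (s * - k * m%:R) = (s ^+ 2 * m%:R) * k ^+ 2 by ring.
  by rewrite sE mulrC kE.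
have sq x : gnorm G x ^+ 2 = bilin G x x by exact: gnorm_sqr.
have vN i : gnorm G (v (Some i) - v None) ^+ 2 = 2 * (m%:R + 1) / m%:R.
  rewrite sq /v -scalerBr scaleNr opprK -addrA -scalerDl.
  rewrite expand ee bilinZr e1 bilinZl bilinZr oneone -expr2.
  apply: (mulIf (lt0r_neq0 mr0)); rewrite divfK ?gt_eqF//.
  set c := al + k.
  have cE : m%:R * c = k * (m%:R + 1) - 1 by rewrite /c mulrDr alE; ring.
  have -> : s ^+ 2 * (1 + 2 * (c * 1) + c * (c * m%:R)) * m%:R =
    s ^+ 2 * (m%:R + 2 * (m%:R * c) + (m%:R * c) ^+ 2) by ring.
  rewrite cE.
  have -> : m%:R + 2 * (k * (m%:R + 1) - 1) + (k * (m%:R + 1) - 1) ^+ 2 =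
    m%:R - 1 + (k ^+ 2 * (m%:R + 1)) * (m%:R + 1) by ring.
  by rewrite kE; move: sE; lra.
exists v; split; first 1 last.
- by move=> i; rewrite /gnorm vv sqrtr1.
- move=> [i|] [j|] //.
  + rewrite (inj_eq Some_inj) => ij; rewrite sq /v -scalerBr.
    rewrite opprD addrACA subrr addr0 expand !bilinNl !bilinNr opprK !eo eqxx (negbTE ij).
    rewrite eqxx mulrN mulr0 oppr0 addr0 -expr2.
    by apply: (mulIf (lt0r_neq0 mr0)); rewrite divfK ?gt_eqF// !mulr1n; move: sE; lra.
  + by move=> _; rewrite gnormB; exact: vN.
rewrite /v -scaler_sumr.
rewrite (bigD1 None)//= (reindex_onto Some (fun i => if i is Some j then j else Ordinal m0))/=; last by case.
rewrite (eq_bigl xpredT) => [|i]; last by rewrite eqxx.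
rewrite big_split/= sumr_const card_ord -/one.
have -> : - k *: one + (one + (al *: one) *+ m) = (1 + m%:R * al - k) *: one.
  by rewrite scalerBl scalerDl scale1r -scaler_nat scalerA addrC scaleNr.
by rewrite alE addrCA subrr addr0 subrr scale0r scaler0.
Qed.

End simplex.

Lemma bilin_norm_le (R : realType) m (A : 'M[R]_m) (u v : 'rV[R]_m) :
  `|bilin A u v| <= m%:R ^+ 2 * `|A| * `|u| * `|v|.
Proof.
rewrite bilinE; apply: le_trans (ler_norm_sum _ _ _) _.
apply: (@le_trans _ _ (\sum_(j < m) m%:R * `|A| * `|u| * `|v|)); last first.
  by rewrite sumr_const card_ord le_eqVlt; apply/orP; left; apply/eqP; ring.
apply: ler_sum => j _; rewrite normrM ler_pM ?mx_entry_le_norm//.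
apply: le_trans (ler_norm_sum _ _ _) _.
apply: (@le_trans _ _ (\sum_(i < m) `|A| * `|u|)); last first.
  by rewrite sumr_const card_ord le_eqVlt; apply/orP; left; apply/eqP; ring.
by apply: ler_sum => i _; rewrite normrM mulrC ler_pM ?mx_entry_le_norm.
Qed.

(** * The metric tensor in a chart *)

Lemma differentiable_lipschitz (R : realType) (m : nat) (W : normedModType R)
    (f : 'rV[R]_m -> W) x : differentiable f x ->
  exists2 K, 0 < K & \forall h \near (0 : 'rV[R]_m), `|f (h + x) - f x| <= K * `|h|.
Proof.
move=> dfx; have [k k0 kP] := linear_lipschitz (diff_continuous dfx).
exists (k + 1); first by rewrite addr_gt0.
have /eqaddoP/(_ 1 ltr01) := diff_locally dfx.
apply: filterS => h; rewrite /= mul1r => hh.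
rewrite mulrDl mul1r -(subrK ('d f x h) (f (h + x) - f x)) addrC.
apply: le_trans (ler_normD _ _) _; apply: lerD; first exact: kP.
by apply: le_trans hh; rewrite -[X in _ <= `|X|]/(f (h + x) - (f x + 'd f x h)) opprD addrA.
Qed.

Lemma is_derive_bilin (R : realType) m (G : 'M[R]_m) (w : 'rV[R]_m)
    (f : R -> 'rV[R]_m) (t : R) : derivable f t 1 ->
  is_derive t (1 : R) (fun s => bilin G w (f s)) (bilin G w (derive1 f t)).
Proof.
move=> df.
have H : (fun h : R => h^-1 *: (bilin G w (f (h *: 1 + t)) - bilin G w (f t))) @ 0^'
    --> bilin G w (derive1 f t).
  rewrite (_ : (fun h => _) = (fun h : R => bilin G w (h^-1 *: (f (h *: 1 + t) - f t)))); last first.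
    by apply/funext => h; rewrite bilinZr bilinDr bilinNr.
  apply: bilin_cvg; [exact: cvg_cst|exact: cvg_cst|].
  by rewrite derive1E; exact: df.
by constructor; [apply/cvg_ex; eexists; exact: H|exact: cvg_lim H].
Qed.

Section chart_derivative.
Variables (R : realType) (m : nat) (M : topologicalType).
Variables (S : smooth_manifold R m M) (g : riemannian_metric S).

(** [C1_curve_at] provides a continuous derivative only in its own chart [c1]; passing to [c]
    multiplies it by the Jacobian of the transition map. *)
Lemma derive1_chart_cvg sigma t c : C1_curve_at S sigma t -> atlas S c ->
  chart_dom c (sigma t) ->
  derive1 (c \o sigma) s @[s --> t] --> derive1 (c \o sigma) t.
Proof.
move=> st Sc ct; have [c1 [U [Sc1 oU Ut sU [C0 C1]]]] := st.
have nU : \forall s \near t, U s by exact: (open_nbhs_nbhs (conj oU Ut)).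
have nc : \forall s \near t, chart_dom c (sigma s).
  exact: (C1_curve_cvg st (near_chart_dom ct)).
have [d1 [c1' _]] := C1 1.
pose tau := c \o chart_inv c1.
have ov s : U s -> chart_dom c (sigma s) -> overlap c1 c (c1 (sigma s)).
  by move=> Us cs; exists (sigma s) => //; split=> //; apply: sU; exists s.
(* [Ck_on] gives continuity of the derivative in each fixed direction, so the varying velocity is
   expanded in the standard basis. *)
pose F s := \sum_j (derive1 (c1 \o sigma) s) 0 j *: 'D_('e_j) tau (c1 (sigma s)).
have E : \forall s \near t, F s = derive1 (c \o sigma) s.
  near=> s; have Us : U s by near: s.
  have cs : chart_dom c (sigma s) by near: s.
  have dtau := transition_differentiable Sc1 Sc (ov _ Us cs).
  have ds : differentiable (c1 \o sigma) s by exact/derivable1_diffP/d1.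
  have Es : \forall x \near s, (c \o sigma) x = (tau \o (c1 \o sigma)) x.
    apply: filterS (open_nbhs_nbhs (conj oU Us)) => x Ux /=.
    by rewrite /tau/= chart_mapK_dom//; apply: sU; exists x.
  symmetry; rewrite derive1E (near_eq_derive _ Es) deriveE; last exact: differentiable_comp.
  have e1 : 'd (c1 \o sigma) s 1 = derive1 (c1 \o sigma) s by rewrite derive1E deriveE.
  rewrite diff_comp//= e1 {1}[derive1 _ s]row_sum_delta linear_sum.
  by apply: eq_bigr => j _; rewrite linearZ/= deriveE.
have Ft : F t = derive1 (c \o sigma) t := nbhs_singleton E.
rewrite -Ft; apply: (@cvg_trans _ (F s @[s --> t])).
  exact: near_eq_cvg.
have H j : (derive1 (c1 \o sigma) s) 0 j *: 'D_('e_j) tau (c1 (sigma s)) @[s --> t] -->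
    (derive1 (c1 \o sigma) t) 0 j *: 'D_('e_j) tau (c1 (sigma t)).
  have dc : derive1 (c1 \o sigma) s @[s --> t] --> derive1 (c1 \o sigma) t.
    rewrite (_ : derive1 _ = 'D_1 (c1 \o sigma)); last by apply/funext => y; rewrite derive1E.
    by apply: c1'; exact: mem_set.
  have sc : (derive1 (c1 \o sigma) s) 0 j @[s --> t] --> (derive1 (c1 \o sigma) t) 0 j.
    exact: mx_entry_cvg dc.
  have Dc : 'D_('e_j) tau (c1 (sigma s)) @[s --> t] --> 'D_('e_j) tau (c1 (sigma t)).
    have [_ [H0 _]] := (atlas_smooth Sc1 Sc 1%N).2 'e_j.
    have H1 := H0 _ (mem_set (ov _ Ut ct)).
    apply: (@cvg_comp _ _ _ (c1 \o sigma) ('D_('e_j) tau) _ (nbhs (c1 (sigma t)))).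
      exact: C0 _ (mem_set Ut).
    exact: H1.
  exact: (cvgZ sc Dc).
exact: sum_cvg H.
Unshelve. all: by end_near. Qed.
End chart_derivative.

Section local.
Variables (R : realType) (m : nat) (M : topologicalType).
Variables (S : smooth_manifold R m M) (g : riemannian_metric S) (p0 : M).

Let c := chart_at S p0.
Let Sc : atlas S c := chart_at_atlas S p0.
Let cp0 : chart_dom c p0 := chart_at_dom S p0.
Definition gram_at : 'M[R]_m := gram g c (c p0).
Notation G := gram_at.
Notation N := (gnorm G).

Lemma gram_at_sym : G^T = G.
Proof. by apply: gram_sym => //; exists p0. Qed.

Lemma gram_at_pos (u : 'rV[R]_m) : u != 0 -> 0 < bilin G u u.
Proof. by apply: gram_posdef => //; exists p0. Qed.

(** Differentiability of [gram] at the centre gives a Lipschitz bound there. The condition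
    [C * d <= 1] keeps [1 - C * r] nonnegative for all [r < d]. *)
Lemma gram_estimate : exists C d : R, [/\ 0 < C, 0 < d, C * d <= 1 &
  forall x, N x < d -> (c @` chart_dom c) (c p0 + x) /\
    forall u, `|bilin (gram g c (c p0 + x)) u u - bilin G u u| <= C * N x * N u ^+ 2].
Proof.
have [K K0 KP] : exists2 K, 0 < K & \forall h \near (0 : 'rV[R]_m),
    `|gram g c (h + c p0) - G| <= K * `|h|.
  apply: differentiable_lipschitz.
  apply: (C1_differentiable (chart_img_open (c := c)) (gram_smooth g Sc 1%N)).
  by exists p0.
have Kimg : \forall h \near (0 : 'rV[R]_m), (c @` chart_dom c) (h + c p0).
  by have := near_chart_img cp0; rewrite (near_shift 0) /= subr0.
have [C1 C10 C1P] := norm_le_gnorm gram_at_sym gram_at_pos.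
have := filterI KP Kimg => /(_ _)/nbhs_ballP[d /= d0 dP].
(* [K] is the Lipschitz constant of [gram], and [C1] converts the coordinate norm into [N], once for
   [x] and twice for [u]; the [1] makes [C] positive. *)
pose C := m%:R ^+ 2 * K * C1 ^+ 3 + 1.
have C0 : 0 < C by rewrite ltr_wpDl// !mulr_ge0 ?exprn_ge0// ltW.
exists C, (Num.min (C^-1) (d / C1)); split => //.
- by rewrite lt_min invr_gt0 C0 divr_gt0.
- by rewrite -ler_pdivlMl// mulr1 ge_min lexx.
move=> x; rewrite lt_min ltr_pdivlMr// => /andP[_ xd].
have xb : `|x| < d by apply: le_lt_trans (C1P x) _; rewrite mulrC.
have [h1 h2] : (`|gram g c (x + c p0) - G| <= K * `|x|) /\ (c @` chart_dom c) (x + c p0).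
  by apply: dP; rewrite -ball_normE /= sub0r normrN.
rewrite addrC; split=> // u.
have -> : bilin (gram g c (x + c p0)) u u - bilin G u u =
    bilin (gram g c (x + c p0) - G) u u.
  by rewrite /bilin mulmxBr mulmxBl !mxE.
apply: le_trans (bilin_norm_le _ _ _) _.
have N0 := gnorm_ge0 G.
apply: (@le_trans _ _ (m%:R ^+ 2 * (K * (C1 * N x)) * (C1 * N u) * (C1 * N u))).
  rewrite ler_pM ?mulr_ge0 ?exprn_ge0//.
  rewrite ler_pM ?mulr_ge0 ?exprn_ge0//.
  rewrite ler_wpM2l ?exprn_ge0//.
  by apply: le_trans h1 _; rewrite ler_pM2l.
rewrite /C !mulrDl mul1r.
have -> : m%:R ^+ 2 * (K * (C1 * N x)) * (C1 * N u) * (C1 * N u) =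
  m%:R ^+ 2 * K * C1 ^+ 3 * N x * N u ^+ 2 by ring.
by rewrite lerDl mulr_ge0 ?exprn_ge0.
Qed.

End local.

(** * Local comparison with a Euclidean norm *)

(** [t1] is the infimum of the parameters outside [V]; it is itself outside, since by openness of
    [V] a parameter inside has a whole neighbourhood inside. *)
Lemma first_exit (R : realType) (T : topologicalType) (s : R -> T) (al be t0 : R)
    (V : set T) : open V -> (forall t, al <= t <= be -> s x @[x --> t] --> s t) ->
  V (s al) -> al <= t0 <= be -> ~ V (s t0) ->
  exists t1, [/\ al < t1 <= be, ~ V (s t1) & forall t, al <= t < t1 -> V (s t)].
Proof.
move=> oV sc Va t0ab nV0; pose E := [set t | al <= t <= be /\ ~ V (s t)].
have E0 : E t0 by [].
have lbE : lbound E al by move=> t [/andP[]].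
have iE : has_inf E by split; [exists t0|exists al].
have alT : al <= inf E by apply: lb_le_inf lbE; exists t0.
have Tt t : E t -> inf E <= t by apply: ge_inf; exists al.
have Tbe : inf E <= be by apply: le_trans (Tt _ E0) _; case/andP: t0ab.
have nVT : ~ V (s (inf E)).
  move=> VT; have : \forall x \near inf E, V (s x).
    have Ti : al <= inf E <= be by rewrite alT.
    exact: (sc _ Ti _ (open_nbhs_nbhs (conj oV VT))).
  move=> /nbhs_ballP[eps /= eps0 epsP].
  have [t1 Et1 t1e] := inf_adherent eps0 iE.
  apply: Et1.2; apply: epsP; rewrite /ball/= distrC ger0_norm ?subr_ge0 ?Tt//.
  by rewrite ltrBlDl.
exists (inf E); split=> //.
  rewrite Tbe andbT lt_neqAle alT andbT; apply/eqP => E'.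
  by apply: nVT; rewrite -E'.
move=> t /andP[t1 t2]; apply: contrapT => nVt.
have : E t by split=> //; rewrite t1 (le_trans (ltW t2)).
by move=> /Tt; rewrite leNgt t2.
Qed.

Section local_estimates.
Variables (R : realType) (m : nat) (M : topologicalType).
Variables (S : smooth_manifold R m M) (g : riemannian_metric S) (p0 : M).
Let c := chart_at S p0.
Let Sc : atlas S c := chart_at_atlas S p0.
Let cp0 : chart_dom c p0 := chart_at_dom S p0.
Notation G := (gram_at g p0).
Notation N := (gnorm G).
Let Gs := gram_at_sym g p0.
Let Gp := @gram_at_pos R m M S g p0.
Variables (C d : R).
Hypotheses (C0 : 0 < C) (d0 : 0 < d) (Cd : C * d <= 1).
Hypothesis est : forall x, N x < d -> (c @` chart_dom c) (c p0 + x) /\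
    forall u, `|bilin (gram g c (c p0 + x)) u u - bilin G u u| <= C * N x * N u ^+ 2.

Definition echart (x : 'rV[R]_m) : M := chart_inv (chart_at S p0) (chart_at S p0 p0 + x).
Notation e := echart.

Lemma echart_dom x : N x < d -> chart_dom c (e x) /\ c (e x) = c p0 + x.
Proof. by move=> /est[[q cq qx] _]; rewrite /e -/c -qx chart_mapK_dom. Qed.

Lemma echart0 : e 0 = p0.
Proof. by rewrite /e addr0 chart_mapK_dom. Qed.

Lemma echartK q : chart_dom c q -> e (c q - c p0) = q.
Proof. by move=> cq; rewrite /e addrC subrK chart_mapK_dom. Qed.

(** As [0 <= C r <= 1], one has [(1 - C r)^2 <= 1 - C r] and [1 + C r <= (1 + C r)^2], so the bounds
    on the quadratic form pass to its square root with the same constant. *)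
Lemma gram_norm_bounds x u r : N x <= r -> r < d ->
  (1 - C * r) * N u <= Num.sqrt (bilin (gram g c (c p0 + x)) u u) <= (1 + C * r) * N u.
Proof.
move=> xr rd; have [_ /(_ u)] := est (le_lt_trans xr rd).
have Nu := gnorm_ge0 G u; have Nx := gnorm_ge0 G x.
have r0 : 0 <= r by exact: le_trans xr.
rewrite -(gnorm_sqr Gp) ler_norml => /andP[h1 h2].
have Cr1 : C * r <= 1 by apply: le_trans Cd; rewrite ler_pM2l// ltW.
have Cxr : C * N x <= C * r by rewrite ler_pM2l.
have Cr0 : 0 <= C * r by rewrite mulr_ge0// ltW.
have h3 : C * N x * N u ^+ 2 <= C * r * N u ^+ 2 by rewrite ler_wpM2r// sqr_ge0.
have q0 : 0 <= N u ^+ 2 by rewrite sqr_ge0.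
set B := bilin _ u u in h1 h2 *.
have B1 : ((1 - C * r) * N u) ^+ 2 <= B.
  rewrite exprMn; apply: (@le_trans _ _ ((1 - C * r) * N u ^+ 2)); last by nra.
  by rewrite ler_wpM2r// expr2 ler_piMl ?subr_ge0// lerBlDr lerDl.
have B2 : B <= ((1 + C * r) * N u) ^+ 2.
  rewrite exprMn; apply: (@le_trans _ _ ((1 + C * r) * N u ^+ 2)); first by nra.
  by rewrite ler_wpM2r// expr2 ler_peMl ?lerDl// addr_ge0.
have B0 : 0 <= B by apply: le_trans B1; exact: sqr_ge0.
apply/andP; split.
  rewrite -(ler_pXn2r (n := 2))// ?nnegrE ?sqrtr_ge0//; first by rewrite sqr_sqrtr.
  by rewrite mulr_ge0// subr_ge0.
rewrite -(ler_pXn2r (n := 2))// ?nnegrE ?sqrtr_ge0//; first by rewrite sqr_sqrtr.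
by rewrite mulr_ge0// addr_ge0.
Qed.

(** The straight coordinate segment stays in the [N]-ball of radius [r] by convexity, so its speed
    is bounded throughout. *)
Lemma segment_chain x y r : N x <= r -> N y <= r -> r < d ->
  exists2 l, chain g (e x) (e y) l & l <= (1 + C * r) * N (y - x).
Proof.
move=> xr yr rd; pose z t := x + t *: (y - x).
pose s t := e (z t).
have zr t : 0 <= t <= 1 -> N (z t) <= r.
  move=> /andP[t0 t1]; have -> : z t = (1 - t) *: x + t *: y.
    by rewrite /z scalerBr scalerBl scale1r addrA addrAC.
  apply: le_trans (gnormD Gs Gp _ _) _; rewrite !gnormZ (ger0_norm t0) ger0_norm ?subr_ge0//.
  by rewrite -[leRHS]mul1r -[X in X * r](subrK t 1) [leRHS]mulrDl lerD// ler_wpM2l// subr_ge0.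
have zc t : z s @[s --> t] --> z t.
  apply: cvgD; first exact: cvg_cst.
  have h1 : s @[s --> t] --> t by exact: cvg_id.
  have h2 : y - x @[s --> t] --> y - x by exact: cvg_cst.
  exact: (cvgZ h1 h2).
pose U := [set t | N (z t) < d].
have nU t : U t -> \forall s \near t, U s.
  move=> Ut; have h : N (z s) @[s --> t] --> N (z t) by apply: (gnorm_cvg (zc t)).
  exact: (h _ (lt_nbhsl Ut)).
have oU : open U by rewrite openE => t /nU.
have E t : U t -> c (s t) = c p0 + z t by move=> /echart_dom[].
have dz t : is_derive t (1 : R) (fun s => c p0 + z s) (y - x).
  have h1 : is_derive t (1 : R) (fun s => z s) (y - x).
    have := @is_derive_line R _ _ id x (y - x) t.
    by rewrite derive_id; apply; exact: derivable_id.
  have := is_deriveD (is_derive_cst (c p0) t (1 : R)) h1.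
  by rewrite add0r.
have dcs t : U t -> is_derive t (1 : R) (c \o s) (y - x).
  move=> Ut; apply: near_eq_is_derive (dz t).
  by apply: filterS (nU t Ut) => w Uw; rewrite /= E.
have d1 t : U t -> derive1 (c \o s) t = y - x.
  by move=> Ut; rewrite derive1E; have [_ ->] := dcs _ Ut.
have C1 : Ck_on 1 U (c \o s).
  apply: Ck_on1_real => // [t Ut|t Ut]; first by have [] := dcs _ Ut.
  rewrite d1//.
  have h2 : (y - x : 'rV[R]_m) @[s --> t] --> y - x by exact: cvg_cst.
  apply: cvg_trans h2.
  by apply: near_eq_cvg; near=> w; rewrite d1//; near: w; exact: nU.
have U01 t : 0 <= t <= 1 -> U t by move=> /zr h; exact: le_lt_trans h rd.
have sC t : 0 <= t <= 1 -> C1_curve_at S s t.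
  move=> /U01 Ut; exists c, U; split=> //.
  by move=> _ [w Uw <-]; have [] := echart_dom Uw.
exists (plen g s 0 1).
  have := chain_piece g ler01 sC; rewrite /s /z scale0r addr0 scale1r.
  by rewrite addrC subrK.
rewrite -[leRHS]mulr1 -[X in _ * X](subr0 1).
apply: plen_le => // t t01.
have [ct _] := echart_dom (U01 _ t01).
have [_ ->] := speed_chart g (sC _ t01) Sc ct.
rewrite /chart_speed d1 ?E; [|exact: U01|exact: U01].
by have /andP[] := gram_norm_bounds (y - x) (zr _ t01) rd.
Unshelve. all: by end_near. Qed.

(* Integrate the derivative of the linear function [bilin G w] along the arc,
   where [w] is the difference of the end points. *)
Lemma piece_lower s al T r : al <= T -> C1_on S s al T -> r < d ->
  (forall t, al <= t <= T -> chart_dom c (s t) /\ N (c (s t) - c p0) <= r) ->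
  (1 - C * r) * N (c (s T) - c (s al)) <= plen g s al T.
Proof.
rewrite le_eqVlt => /predU1P[<- _ _ _|alT sC rd sV].
  by rewrite subrr gnorm0 mulr0 plen_ge0.
set w := c (s T) - c (s al).
have [->|w0] := eqVneq w 0; first by rewrite gnorm0 mulr0 plen_ge0.
have Nw := gnorm_gt0 Gp w0.
pose h t := bilin G w (c (s t)).
pose h' t := bilin G w (derive1 (c \o s) t).
have dh t : al <= t <= T -> is_derive t (1 : R) h (h' t).
  move=> tt; apply: is_derive_bilin.
  exact: (speed_chart g (sC _ tt) Sc (sV _ tt).1).1.
have ch' : {within `[al, T], continuous h'}.
  apply/continuous_in_subspaceT => t /set_mem /=; rewrite in_itv/= => tt.
  apply: bilin_cvg; [exact: cvg_cst|exact: cvg_cst|].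
  exact: derive1_chart_cvg (sC _ tt) Sc (sV _ tt).1.
have hc t : al <= t <= T -> h x @[x --> t] --> h t.
  move=> /dh[h1 _]; apply: differentiable_continuous; exact/derivable1_diffP.
have ftc : (\int[lebesgue_measure]_(t in `[al, T]) (h' t)%:E = (h T)%:E - (h al)%:E)%E.
  apply: continuous_FTC2 => //.
    split.
    - by move=> t /subset_itv_oo_cc; rewrite in_itv/= => /dh[].
    - by apply/cvg_at_right_filter/hc; rewrite lexx ltW.
    - by apply/cvg_at_left_filter/hc; rewrite lexx ltW.
  by move=> t /subset_itv_oo_cc; rewrite in_itv/= => /dh[_ h2]; rewrite derive1E.
have ih' : lebesgue_measure.-integrable `[al, T] (EFin \o h').
  by apply: continuous_compact_integrable => //; exact: segment_compact.
have le t : al <= t <= T -> (1 - C * r) * h' t <= N w * speed g s t.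
  move=> tt; have [ct cr] := sV _ tt.
  have [_ ->] := speed_chart g (sC _ tt) Sc ct.
  have /andP[lo _] := gram_norm_bounds (derive1 (c \o s) t) cr rd.
  have Ec : c p0 + (c (s t) - c p0) = c (s t) by rewrite addrC subrK.
  rewrite Ec in lo.
  have r0 : 0 <= r by apply: le_trans cr; exact: gnorm_ge0.
  have k0 : 0 <= 1 - C * r by rewrite subr_ge0; apply: le_trans Cd; rewrite ler_pM2l// ltW.
  apply: (@le_trans _ _ ((1 - C * r) * (N w * N (derive1 (c \o s) t)))).
    by rewrite ler_wpM2l// (cauchy_schwarz Gs Gp).
  by rewrite mulrCA ler_pM2l.
have main : (1 - C * r) * N w ^+ 2 <= N w * plen g s al T.
  have i1 : \int[lebesgue_measure]_(t in `[al, T]) h' t = N w ^+ 2.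
    by rewrite /Rintegral ftc/= (gnorm_sqr Gp) {2}/w bilinDr bilinNr.
  have i2 : \int[lebesgue_measure]_(t in `[al, T]) ((1 - C * r) * h' t) = (1 - C * r) * N w ^+ 2.
    by rewrite -i1; apply: RintegralZl.
  have isp := speed_integrable g sC.
  have i3 : \int[lebesgue_measure]_(t in `[al, T]) (N w * speed g s t) = N w * plen g s al T.
    by apply: RintegralZl.
  rewrite -i2 -i3.
  have j1 : lebesgue_measure.-integrable `[al, T] (EFin \o (fun t => (1 - C * r) * h' t)).
    rewrite (_ : _ \o _ = (fun t => (1 - C * r)%:E * (EFin \o h') t)%E); first exact: integrableZl.
    by apply/funext => t; rewrite /= EFinM.
  have j2 : lebesgue_measure.-integrable `[al, T] (EFin \o (fun t => N w * speed g s t)).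
    rewrite (_ : _ \o _ = (fun t => (N w)%:E * (EFin \o speed g s) t)%E); first exact: integrableZl.
    by apply/funext => t; rewrite /= EFinM.
  exact: (le_Rintegral _ j1 j2).
by rewrite -(ler_pM2l Nw) mulrCA -expr2.
Qed.

Definition chart_ball r := [set p | chart_dom c p /\ N (c p - c p0) < r].

Lemma gnorm_chart_cvg p : chart_dom c p -> N (c q - c p0) @[q --> p] --> N (c p - c p0).
Proof.
move=> cp; have h1 : c p0 @[q --> p] --> c p0 by exact: cvg_cst.
by apply: (gnorm_cvg (cvgB (chart_cvg cp) h1)).
Qed.

Lemma chart_ball_open r : open (chart_ball r).
Proof.
rewrite openE => p [cp pr]; apply: filterI; first exact: near_chart_dom.
exact: (gnorm_chart_cvg cp (lt_nbhsl pr)).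
Qed.

Lemma echart_shift_cvg (x : 'rV[R]_m) : c p0 + y @[y --> x] --> c p0 + x.
Proof.
have FF : Filter (nbhs x) := nbhs_filter x.
have k1 : c p0 @[y --> x] --> c p0 by exact: cvg_cst.
have k2 : y @[y --> x] --> x by exact: cvg_id.
exact: (cvgD k1 k2).
Qed.

(** Closed in [M], not merely in the chart domain: the set is the image of a compact ball, and [M]
    is Hausdorff. This keeps the limit of a curve at its exit time inside the chart. *)
Lemma chart_ball_closed r : r < d ->
  closed [set p | chart_dom c p /\ N (c p - c p0) <= r].
Proof.
move=> rd; rewrite (_ : [set p | _] = e @` [set x | N x <= r]); last first.
  apply/seteqP; split=> [p [cp pr]|_ [x /= xr <-]].
    by exists (c p - c p0) => //; exact: echartK.
  have [h1 h2] := echart_dom (le_lt_trans xr rd).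
  by split=> //; rewrite h2 addrAC subrr add0r.
apply: compact_closed; first exact: manifold_hausdorff S.
apply: continuous_compact.
  apply/continuous_in_subspaceT => x /set_mem /= xr.
  have [h1 h2] := echart_dom (le_lt_trans xr rd).
  apply: (@cvg_comp _ _ _ (fun x => c p0 + x) (chart_inv c) _ (nbhs (c p0 + x))).
    exact: echart_shift_cvg.
  by rewrite -h2; exact: (chart_inv_cvg h1).
apply: bounded_closed_compact.
  have [C1 C10 C1P] := norm_le_gnorm Gs Gp.
  exists (C1 * r); split; first exact: num_real.
  move=> b rb x /= xr; apply: le_trans (C1P x) _; apply: le_trans (ltW rb).
  by rewrite ler_pM2l.
have -> : [set x | N x <= r] = N @^-1` [set k | k <= r] by [].
apply: (@closed_comp _ _ N); last exact: closed_le.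
move=> x _; have FF : Filter (nbhs x) := nbhs_filter x.
have k2 : y @[y --> x] --> x by exact: cvg_id.
exact: (gnorm_cvg k2).
Qed.

(** The arc is compared with coordinates only up to its first exit, because it may leave the chart
    afterwards. The exit point is recorded by its coordinate vector [w] on the sphere; the rest of
    the arc only adds length. *)
Lemma piece_exit s al be r : al <= be -> C1_on S s al be -> r < d ->
  chart_ball r (s al) ->
  (chart_ball r (s be) /\ (1 - C * r) * N (c (s be) - c (s al)) <= plen g s al be) \/
  exists w, N w = r /\ (1 - C * r) * N (w - (c (s al) - c p0)) <= plen g s al be.
Proof.
move=> ab sC rd Va.
have [allV|] := pselect (forall t, al <= t <= be -> chart_ball r (s t)).
  left; split; first by apply: allV; rewrite ab lexx.
  by apply: piece_lower => // t /allV[h1 /ltW].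
move=> /existsNP[t0 /not_implyP[t0ab nV0]]; right.
have sc t : al <= t <= be -> s x @[x --> t] --> s t by move=> /sC/C1_curve_cvg.
have [T [/andP[alT Tbe] nVT TV]] := first_exit (@chart_ball_open r) sc Va t0ab nV0.
have Tab : al <= T <= be by rewrite (ltW alT).
(* [s T] is outside the open ball; that it still has coordinates follows by a limit from the left in
   the closed one. *)
have [cT rT] : chart_dom c (s T) /\ N (c (s T) - c p0) <= r.
  apply: (@closed_cvg _ _ (T^'-) _ s [set p | chart_dom c p /\ N (c p - c p0) <= r]).
  - exact: chart_ball_closed.
  - near=> t; have [|h1 /ltW h2] // := TV t.
    apply/andP; split; last by near: t; exact: nbhs_left_lt.
    by near: t; exact: nbhs_left_ge.
  - exact/cvg_at_left_filter/sc.
have NT : N (c (s T) - c p0) = r.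
  apply/eqP; rewrite eq_le rT leNgt; apply/negP => h; exact: nVT.
exists (c (s T) - c p0); split=> //.
rewrite (plen_split g sC (ltW alT) Tbe) opprB addrA subrK.
apply: ler_wpDr; first exact: plen_ge0.
apply: piece_lower => //; [exact: ltW|exact: C1_on_sub sC _ _|].
move=> t /andP[t1]; rewrite le_eqVlt => /predU1P[->//|tT].
by have [|h1 /ltW] := TV t; rewrite ?t1.
Unshelve. all: by end_near. Qed.

Lemma chain_lower p q l r : r < d -> chain g p q l -> chart_ball r p ->
  (chart_ball r q /\ (1 - C * r) * N (c q - c p) <= l) \/
  exists w, N w = r /\ (1 - C * r) * N (w - (c p - c p0)) <= l.
Proof.
move=> rd; elim=> {p q l} [p Vp|s al be q l ab sC ch IH Va].
  by left; split=> //; rewrite subrr gnorm0 mulr0.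
have r0 : 0 <= r by apply: le_trans (ltW Va.2); exact: gnorm_ge0.
have k0 : 0 <= 1 - C * r by rewrite subr_ge0; apply: le_trans Cd; rewrite ler_pM2l// ltW.
have [[Vb h1]|[w [wr h]]] := piece_exit ab sC rd Va; last first.
  by right; exists w; split=> //; apply: ler_wpDr h; exact: chain_ge0 ch.
have [[Vq h2]|[w [wr h]]] := IH Vb; [left|right; exists w]; split=> //.
  apply: le_trans (lerD h1 h2); rewrite -mulrDr ler_wpM2l//.
  have -> : c q - c (s al) = (c (s be) - c (s al)) + (c q - c (s be)).
    by rewrite [RHS]addrC addrA subrK.
  exact: (gnormD Gs Gp).
apply: le_trans (lerD h1 h); rewrite -mulrDr ler_wpM2l//.
have -> : w - (c (s al) - c p0) = (c (s be) - c (s al)) + (w - (c (s be) - c p0)).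
  by rewrite !opprB [RHS]addrC -addrA; congr (_ + _); rewrite addrA subrK.
exact: (gnormD Gs Gp).
Qed.

Lemma chain_lower_exit q l r : 0 < r -> r < d -> chain g p0 q l -> ~ chart_ball r q ->
  (1 - C * r) * r <= l.
Proof.
move=> r0 rd ch nV; have Vp : chart_ball r p0 by split=> //; rewrite subrr gnorm0.
have [[//]|[w [wr]]] := chain_lower rd ch Vp.
by rewrite subrr subr0 wr.
Qed.

(** A chain from radius at most [r] that reaches radius [3 * r] covers a coordinate distance of at
    least [2 * r], which is no less than [N (y - x)]. Hence the factor 3. *)
Lemma chain_lower_ball x y l r : 0 < r -> 3 * r < d -> N x <= r -> N y <= r ->
  chain g (e x) (e y) l -> (1 - 3 * C * r) * N (y - x) <= l.
Proof.
move=> r0 rd xr yr ch.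
have r3 : r < 3 * r by lra.
have rd' : r < d by exact: lt_trans r3 rd.
have [cx ex] := echart_dom (le_lt_trans xr rd').
have [cy ey] := echart_dom (le_lt_trans yr rd').
have Vx : chart_ball (3 * r) (e x).
  by split=> //; rewrite ex addrAC subrr add0r; exact: le_lt_trans r3.
have -> : 3 * C * r = C * (3 * r) by rewrite mulrCA mulrA.
have k0 : 0 <= 1 - C * (3 * r) by rewrite subr_ge0; apply: le_trans Cd; rewrite ler_pM2l// ltW.
have [[_]|[w [wr]]] := chain_lower rd ch Vx.
  by rewrite ex ey opprD addrACA subrr add0r.
rewrite ex addrAC subrr add0r; apply: le_trans; rewrite ler_wpM2l//.
have h1 : N (y - x) <= r + r.
  by apply: le_trans (gnormD Gs Gp _ _) _; rewrite gnormN lerD.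
have h2 : N w <= N (w - x) + N x.
  by rewrite -{1}(subrK x w); exact: (gnormD Gs Gp).
lra.
Qed.

End local_estimates.

(** * The Riemannian distance is a length metric *)

Section rdist_metric.
Variables (R : realType) (m : nat) (M : topologicalType).
Variables (S : smooth_manifold R m M) (g : riemannian_metric S).
Hypothesis hM : connected [set: M].

Lemma near_chain p : \forall q \near p, exists l, chain g p q l.
Proof.
have [C [d [C0 d0 Cd est]]] := gram_estimate g p.
have d2 : d / 2 < d by lra.
have Vp : chart_ball g p (d / 2) p.
  by split; [exact: chart_at_dom|rewrite subrr gnorm0 divr_gt0].
apply: filterS (open_nbhs_nbhs (conj (@chart_ball_open _ _ _ _ g p (d / 2)) Vp)) => q [qc qd].
have N0 : gnorm (gram_at g p) 0 <= d / 2 by rewrite gnorm0 divr_ge0// ltW.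
have [l cl _] := segment_chain C0 Cd est N0 (ltW qd) d2.
by exists l; move: cl; rewrite echart0 echartK.
Qed.

(** Nearby points are joined by coordinate segments, so the points reachable from [p] form an open
    set and so do the others; connectedness concludes. *)
Lemma chain_exists p q : exists l, chain g p q l.
Proof.
pose B := [set q | exists l, chain g p q l].
suff : B = [set: M] by move=> /seteqP[_ /(_ q I)].
have oB : open B.
  rewrite openE => x [l pl]; apply: filterS (near_chain x) => y [l' xy].
  by exists (l + l'); exact: chain_cat pl xy.
have cB : closed B.
  rewrite -openC openE => x nB; apply: filterS (near_chain x) => y [l' xy] [l py].
  by apply: nB; exists (l + l'); exact: chain_cat py (chain_sym xy).
apply: hM.
- by exists p, 0; exact: chain_nil.
- by exists B => //; rewrite setTI.
- by exists B => //; rewrite setTI.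
Qed.

Notation d := (rdist g).

Lemma rdist_chain_lt p q e : 0 < e -> exists2 l, chain g p q l & l < d p q + e.
Proof. by have [l0 cl] := chain_exists p q; exact: rdist_chain cl. Qed.

(** This rests on the existence of a chain: an empty infimum is [+oo], which [fine] sends to 0. *)
Lemma rdist_ge p q k : (forall l, chain g p q l -> k <= l) -> k <= d p q.
Proof.
move=> kl; apply/ler_addgt0Pl => e e0.
have [l cl le] := rdist_chain_lt p q e0.
by rewrite addrC; apply: le_trans (kl _ cl) (ltW le).
Qed.

Lemma rdistxx p : d p p = 0.
Proof.
apply/eqP; rewrite eq_le rdist_ge0 andbT.
by apply: rdist_le_chain; exact: chain_nil.
Qed.

Lemma rdistC p q : d p q = d q p.
Proof.
by apply/eqP; rewrite eq_le; apply/andP; split; apply: rdist_ge => l cl;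
  apply: rdist_le_chain; exact: chain_sym.
Qed.

Lemma rdist_triangle q p r : d p r <= d p q + d q r.
Proof.
apply/ler_addgt0Pl => e e0; have e2 : 0 < e / 2 by rewrite divr_gt0.
have [l cl le] := rdist_chain_lt p q e2.
have [l' cl' le'] := rdist_chain_lt q r e2.
have := rdist_le_chain (chain_cat cl cl'); lra.
Qed.

(** These two clauses are what the almost Euclidean part knows of the distance in the chart. The
    second holds because a chain to a point outside the coordinate ball must first reach its
    sphere. *)
Lemma rdist_local a : exists C delta, [/\ 0 < C, 0 < delta,
  (forall r x y, 0 < r < delta -> gnorm (gram_at g a) x <= r -> gnorm (gram_at g a) y <= r ->
    (1 - C * r) * gnorm (gram_at g a) (y - x) <= d (echart S a x) (echart S a y) <=
    (1 + C * r) * gnorm (gram_at g a) (y - x)) &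
  (forall r q, 0 < r < delta -> d a q < (1 - C * r) * r ->
    exists2 x, q = echart S a x & gnorm (gram_at g a) x <= r)].
Proof.
have [C [dl [C0 d0 Cd est]]] := gram_estimate g a.
(* Both factors come from [chain_lower_ball], which works in a ball of triple radius. *)
exists (3 * C), (dl / 3); split; [by rewrite mulr_gt0|by rewrite divr_gt0| |].
  move=> r x y /andP[r0 rd] xr yr; have rd' : 3 * r < dl by lra.
  have Cr : 0 <= C * r by rewrite mulr_ge0 ?ltW.
  apply/andP; split.
    by apply: rdist_ge => l; exact: (chain_lower_ball C0 Cd est).
  have rdl : r < dl by lra.
  have [l /rdist_le_chain h1 h2] := segment_chain C0 Cd est xr yr rdl.
  apply: le_trans h1 _; apply: le_trans h2 _; rewrite ler_wpM2r ?gnorm_ge0//; lra.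
move=> r q /andP[r0 rd] dq; have rdl : r < dl by lra.
have [Vq|nVq] := pselect (chart_ball g a r q).
  by exists (chart_at S a q - chart_at S a a); [rewrite echartK//; exact: Vq.1|exact: ltW Vq.2].
have : (1 - C * r) * r <= d a q.
  by apply: rdist_ge => l ch; exact: (chain_lower_exit C0 Cd est r0 rdl ch).
have : C * r * r <= 3 * C * r * r by rewrite ler_pM2r// ler_pM2r// ler_pMl// ler1n.
lra.
Qed.

(** The glued space has to be a genuine metric space. A point at distance 0 from [p] has coordinates
    by the second clause of [rdist_local], and the first one forces them to vanish. *)
Lemma rdist_eq0 p q : d p q = 0 -> p = q.
Proof.
move=> pq0; have [C [dl [C0 d0 loc exi]]] := rdist_local p.
pose r := Num.min (dl / 2) ((2 * C)^-1).
have r0 : 0 < r by rewrite lt_min divr_gt0// invr_gt0 mulr_gt0.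
have rd : r < dl by rewrite gt_min; apply/orP; left; lra.
have Cr : C * r <= 1 / 2.
  apply: (@le_trans _ _ (C * (2 * C)^-1)); first by rewrite ler_pM2l// ge_min lexx orbT.
  by rewrite invfM mulrCA divff ?gt_eqF// mulr1 mul1r.
have rr : 0 < r < dl by rewrite r0.
have [|x qx xr] := exi r q rr; first by rewrite pq0 mulr_gt0// subr_gt0; lra.
have N0 : gnorm (gram_at g p) 0 <= r by rewrite gnorm0 ltW.
have := loc r 0 x rr N0 xr; rewrite echart0 -qx pq0 subr0 => /andP[h _].
rewrite qx; have [->|x0] := eqVneq x 0; first by rewrite echart0.
exfalso; have := gnorm_gt0 (@gram_at_pos _ _ _ _ g p) x0; nra.
Qed.

Lemma rdist_dist o p q : `|d o p - d o q| <= d p q.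
Proof.
rewrite ler_norml; apply/andP; split.
  by have := rdist_triangle p o q; lra.
by have := rdist_triangle q o p; rewrite (rdistC q p); lra.
Qed.

(** The speed is bounded near [t], so the distance along the curve is Lipschitz at [t]. This feeds
    the intermediate value theorem. *)
Lemma rdist_curve_cvg o s t : C1_curve_at S s t -> d o (s u) @[u --> t] --> d o (s t).
Proof.
move=> st; pose K := speed g s t + 1.
have K0 : 0 < K by rewrite ltr_wpDl// speed_ge0.
have n1 := near_C1_curve st.
have n2 : \forall u \near t, speed g s u < K.
  have sK : speed g s t < K by rewrite ltrDl.
  have h : speed g s u @[u --> t] --> speed g s t by exact: speed_cvg.
  exact: (h _ (lt_nbhsl sK)).
have [e /= e0 eP] : exists2 e : R, 0 < e & forall u, `|t - u| < e ->
    C1_curve_at S s u /\ speed g s u < K.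
  have n12 : nbhs t ([set u | C1_curve_at S s u] `&` [set u | speed g s u < K]).
    exact: filterI.
  by move: n12 => /nbhs_ballP[e e0 eP]; exists e.
have main u : `|t - u| < e -> `|d o (s t) - d o (s u)| <= K * `|t - u|.
  move=> ue; apply: le_trans (rdist_dist _ _ _) _.
  have h al be : al <= be -> (forall w, al <= w <= be -> `|t - w| < e) ->
      d (s al) (s be) <= K * (be - al).
    move=> ab H; have C : C1_on S s al be by move=> w /H/eP[].
    apply: le_trans (rdist_le_chain (chain_piece g ab C)) _.
    by apply: plen_le => // w /H/eP[_ /ltW].
  have [ut|tu] := leP u t.
    rewrite rdistC ger0_norm ?subr_ge0//; apply: h => // w /andP[w1 w2].
    rewrite ger0_norm ?subr_ge0//; apply: le_lt_trans ue.
    by rewrite ger0_norm ?subr_ge0// lerD2l lerN2.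
  rewrite distrC gtr0_norm ?subr_gt0//; apply: h; first exact: ltW.
  move=> w /andP[w1 w2].
  rewrite distrC ger0_norm ?subr_ge0//; apply: le_lt_trans ue.
  by rewrite distrC gtr0_norm ?subr_gt0// lerD2r.
apply/cvgrPdist_le => eps eps0.
have : \forall u \near t, `|t - u| < Num.min e (eps / K).
  apply/nbhs_ballP; exists (Num.min e (eps / K)) => //=.
  by rewrite lt_min e0 divr_gt0.
apply: filterS => u; rewrite lt_min => /andP[u1 u2].
by apply: le_trans (main u u1) _; rewrite mulrC -ler_pdivlMr// ltW.
Qed.

(** The first arc whose end is at distance at least [D] from [o] takes the value [D] by continuity,
    and the chain is cut there. *)
Lemma chain_ivt o p q l D : chain g p q l -> d o p <= D <= d o q ->
  exists z l1 l2, [/\ d o z = D, chain g p z l1, chain g z q l2 & l1 + l2 = l].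
Proof.
elim=> {p q l} [p|s al be q l ab sC ch IH] /andP[D1 D2].
  exists p, 0, 0; split; [|exact: chain_nil|exact: chain_nil|by rewrite addr0].
  by apply/eqP; rewrite eq_le D1.
have [Db|bD] := leP D (d o (s be)); last first.
  have [|z [l1 [l2 [h1 h2 h3 h4]]]] := IH; first by rewrite (ltW bD).
  exists z, (plen g s al be + l1), l2; split=> //; last by rewrite -h4 addrA.
  exact: chain_cons.
have fc : {within `[al, be], continuous (fun t => d o (s t))}.
  apply/continuous_in_subspaceT => t /set_mem /=; rewrite in_itv/= => tab.
  exact: rdist_curve_cvg (sC _ tab).
have [|t] := @IVT R (fun t => d o (s t)) al be D ab fc.
  by rewrite ge_min D1 /= le_max Db orbT.
rewrite in_itv/= => /andP[t1 t2] tD.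
exists (s t), (plen g s al t), (plen g s t be + l); split => //.
- by apply: chain_piece => //; exact: C1_on_sub sC _ _.
- by apply: chain_cons => //; exact: C1_on_sub sC _ _.
- by rewrite addrA -(plen_split g sC t1 t2).
Qed.

(** An almost minimal chain is cut at exactly half the distance from [p], so its excess falls on the
    second half. Exactness on the side of [p] keeps the scales of repeated halving equal to
    [r / 2 ^+ k]. *)
Lemma rdist_midpoint p q e : 0 < e ->
  exists z, d p z = d p q / 2 /\ d z q <= d p q / 2 + e.
Proof.
move=> e0; have [l cl le] := rdist_chain_lt p q e0.
have dpq := rdist_ge0 g p q.
have D : d p p <= d p q / 2 <= d p q by rewrite rdistxx; apply/andP; split; lra.
have [z [l1 [l2 [h1 /rdist_le_chain h2 /rdist_le_chain h3 h4]]]] := chain_ivt cl D.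
by exists z; split=> //; lra.
Qed.

End rdist_metric.

(** * Almost Euclidean metrics *)

Section almost_euclidean.
Variables (R : realType) (m : nat) (M : Type) (d : M -> M -> R).
Hypothesis dxx : forall x, d x x = 0.
Hypothesis dC : forall x y, d x y = d y x.
Hypothesis dT : forall y x z, d x z <= d x y + d y z.
Variables (G : 'M[R]_m) (e : 'rV[R]_m -> M) (C delta : R).
Hypothesis Gs : G^T = G.
Hypothesis Gp : forall u : 'rV[R]_m, u != 0 -> 0 < bilin G u u.
Notation N := (gnorm G).
Notation a := (e 0).
Hypotheses (C0 : 0 < C) (delta0 : 0 < delta).
Hypothesis dN : forall r x y, 0 < r < delta -> N x <= r -> N y <= r ->
  (1 - C * r) * N (y - x) <= d (e x) (e y) <= (1 + C * r) * N (y - x).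
Hypothesis dE : forall r q, 0 < r < delta -> d a q < (1 - C * r) * r ->
  exists2 x, q = e x & N x <= r.

Let ND u v : N (u + v) <= N u + N v. Proof. exact: gnormD. Qed.

(** * Points of the ball lie almost within distance [r] of its complement *)

Section cover.
Hypothesis mid : forall p q eta, 0 < eta ->
  exists z, d p z = d p q / 2 /\ d z q <= d p q / 2 + eta.

(** Intermediate value theorem along the ray: [200 * C * r <= 1] makes the relative error on the
    ball of radius [2 * r] at most [1 / 100], so the distance to [a] reaches [r] before [t = 2 * r],
    at a parameter within 2 percent of [r]. *)
Lemma ray_point r u : N u = 1 -> 0 < r -> 3 * r < delta -> 200 * C * r <= 1 ->
  exists t, [/\ 0 <= t <= 2 * r, d a (e (t *: u)) = r & 99 / 100 * r <= t <= 102 / 100 * r].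
Proof.
move=> u1 r0 rd Cr.
have Nu t : 0 <= t -> N (t *: u) = t by move=> t0; rewrite gnormZ u1 mulr1 ger0_norm.
have Nu' t : N (t *: u) = `|t| by rewrite gnormZ u1 mulr1.
have N0 : N 0 <= 3 * r by rewrite gnorm0; lra.
(* Continuity at [t <= 2 * r] also involves neighbouring parameters, for which radius [3 * r] leaves
   room. *)
have r3 : 0 < 3 * r < delta by lra.
have r2 : 0 < 2 * r < delta by lra.
pose f t := d a (e (t *: u)).
have fc : {within `[0, 2 * r], continuous f}.
  apply/continuous_in_subspaceT => t /set_mem /=; rewrite in_itv/= => /andP[t0 t2].
  apply/cvgrPdist_le => eps eps0.
  have : \forall s \near t, `|t - s| < Num.min r (eps / 2).
    apply/nbhs_ballP; exists (Num.min r (eps / 2)) => //=.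
    by rewrite lt_min r0 divr_gt0.
  apply: filterS => s; rewrite lt_min => /andP[s1 s2].
  have sr : `|s| <= 3 * r.
    by move: s1; rewrite ltr_norml ler_norml => /andP[? ?]; apply/andP; split; lra.
  have tr : `|t| <= 3 * r by rewrite ger0_norm//; lra.
  have : d (e (t *: u)) (e (s *: u)) <= (1 + C * (3 * r)) * `|s - t|.
    have := dN r3; move=> /(_ (t *: u) (s *: u)); rewrite -scalerBl !Nu' => /(_ tr sr).
    by case/andP.
  have h1 : `|s - t| = `|t - s| by rewrite distrC.
  have h2 := dT (e (s *: u)) a (e (t *: u)).
  have h3 := dT (e (t *: u)) a (e (s *: u)).
  have n0 : 0 <= `|t - s| by [].
  rewrite h1 => h4.
  have h5 : d (e (t *: u)) (e (s *: u)) <= eps by nra.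
  rewrite (dC (e (s *: u))) in h2; rewrite /f ler_norml; apply/andP; split; lra.
have f0 : f 0 = 0 by rewrite /f scale0r.
have h t : 0 <= t <= 2 * r -> (1 - C * (2 * r)) * t <= f t <= (1 + C * (2 * r)) * t.
  move=> /andP[t0 t2]; have := dN r2; move=> /(_ 0 (t *: u)).
  by rewrite gnorm0 subr0 Nu// => -> //; lra.
have le02 : 0 <= 2 * r by lra.
have [|t] := @IVT R f 0 (2 * r) r le02 fc.
  rewrite f0; have /andP[h1 _] : (1 - C * (2 * r)) * (2 * r) <= f (2 * r) <= (1 + C * (2 * r)) * (2 * r).
    by apply: h; lra.
  have f2 : r <= f (2 * r) by nra.
  by rewrite ge_min (ltW r0) /= le_max f2 orbT.
rewrite in_itv/= => /andP[t0 t2] ft; exists t; split=> //; first by rewrite t0.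
have /andP[h1 h2] : (1 - C * (2 * r)) * t <= f t <= (1 + C * (2 * r)) * t by apply: h; rewrite t0.
rewrite ft in h1 h2.
have h3 : C * (2 * r) * t <= 1 / 100 * t by rewrite ler_wpM2r//; lra.
apply/andP; split; lra.
Qed.

(* In a Euclidean space [w'] would be [w / 2]; by the parallelogram identity the
   relative deviation is of order [sqrt (C * q)]. *)
Lemma halving_direction q eta w : 0 < q -> 2 * q < delta -> 20 * C * q <= 1 ->
  0 < eta -> N w <= 2 * q -> d a (e w) = q ->
  exists w', [/\ N w' <= q, d a (e w') = q / 2, d (e w') (e w) <= q / 2 + eta &
    N (2 *: w' - w) ^+ 2 <= 18 * C * q ^+ 3].
Proof.
move=> q0 qd Cq eta0 wq aw.
have q2 : 0 < 2 * q < delta by lra.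
have Cq0 : 0 < C * q by rewrite mulr_gt0.
(* The error of the midpoint must not exceed that of the metric at this scale, of order
   [C * q ^+ 2]. *)
pose eta1 := Num.min eta (C * q * q).
have eta10 : 0 < eta1 by rewrite lt_min eta0 mulr_gt0.
have [z [az zw]] := mid a (e w) eta10; rewrite aw in az zw.
have [|w' zE w'q] := dE q2 (q := z); first by rewrite az; nra.
rewrite zE in az zw.
have N0 : N 0 <= 2 * q by rewrite gnorm0; lra.
have /andP[A _] := dN q2 N0 w'q; rewrite subr0 az in A.
have /andP[B _] := dN q2 w'q wq.
have /andP[_ W] := dN q2 N0 wq; rewrite subr0 aw in W.
have e1 : eta1 <= eta by rewrite ge_min lexx.
have e2 : eta1 <= C * q * q by rewrite ge_min lexx orbT.
exists w'; split=> //; [|by apply: le_trans zw _; lra|].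
  by have := gnorm_ge0 G w'; nra.
have := parallelogram Gs Gp w' (w' - w).
have -> : w' + (w' - w) = 2 *: w' - w by rewrite addrA scaler_nat mulr2n.
have -> : w' - (w' - w) = w by rewrite opprB addrCA subrr addr0.
rewrite (gnormB G w' w).
have := gnorm_ge0 G w'; have := gnorm_ge0 G (w - w'); have := gnorm_ge0 G w.
move: A B W; set x := N w'; set y := N (w - w'); set W := N w; set Z := N _ => A B Wq W0 y0 x0 E.
(* The relative error of the comparison on the ball of radius [2 * q]. *)
pose k := 2 * (C * q).
have k0 : 0 < k by rewrite mulr_gt0.
have k1 : k <= 1 / 10 by rewrite /k; lra.
have kE : C * (2 * q) = k by rewrite /k; ring.
rewrite kE in A B Wq.
have {}A : x <= q / 2 * (1 + 2 * k).
  have : (1 - k) * x <= (1 - k) * (q / 2 * (1 + 2 * k)) by nra.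
  by rewrite ler_pM2l; lra.
have {}B : y <= q / 2 * (1 + 4 * k).
  have : (1 - k) * y <= (1 - k) * (q / 2 * (1 + 4 * k)).
    apply: le_trans B _; apply: le_trans zw _.
    have : eta1 <= q * k / 2 by rewrite /k; lra.
    nra.
  by rewrite ler_pM2l; lra.
have {}W0 : q * (1 - k) <= W.
  have : (1 + k) * (q * (1 - k)) <= (1 + k) * W by apply: le_trans Wq; nra.
  by rewrite ler_pM2l; lra.
have [kp2 [kp4 km]] : 0 <= 1 + 2 * k /\ 0 <= 1 + 4 * k /\ 0 <= 1 - k.
  by split; [lra|split; lra].
have q2' : 0 <= q / 2 by rewrite divr_ge0// ltW.
have qk : 0 <= q * (1 - k) by rewrite mulr_ge0// ltW.
have x2 : x ^+ 2 <= (q / 2 * (1 + 2 * k)) ^+ 2.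
  by rewrite ler_pXn2r// nnegrE mulr_ge0.
have y2 : y ^+ 2 <= (q / 2 * (1 + 4 * k)) ^+ 2.
  by rewrite ler_pXn2r// nnegrE mulr_ge0.
have w2 : (q * (1 - k)) ^+ 2 <= W ^+ 2.
  by rewrite ler_pXn2r// nnegrE (le_trans qk).
have -> : 18 * C * q ^+ 3 = 9 * k * q ^+ 2 by rewrite /k; ring.
have -> : Z ^+ 2 = 2 * x ^+ 2 + 2 * y ^+ 2 - W ^+ 2 by rewrite -E addrK.
have q20 : 0 < q ^+ 2 by rewrite exprn_gt0.
(* The terms of order zero in [k] cancel; the rest is at most [9 * k] because [k <= 1 / 10]. *)
have : q ^+ 2 * (8 * k + 10 * k ^+ 2 - k ^+ 2) <= q ^+ 2 * (9 * k).
  by rewrite ler_pM2l//; nra.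
lra.
Qed.

(* The deviations at the scales [r / 2 ^+ k] are dominated by those of a
   geometric series, because the metric is Lipschitz at [a]. *)
Lemma halving_chain r t u : 0 < r -> 2 * r < delta -> C * r <= 1 / 100 * (1 / 100 * (1 / 20)) ->
  N u = 1 -> 0 <= t <= 2 * r -> d a (e (t *: u)) = r ->
  forall k eta, 0 < eta -> exists w, let q := r / 2 ^+ k in
    [/\ N w <= 2 * q, d a (e w) = q, d (e w) (e (t *: u)) <= r - q + eta &
      N (2 ^+ k *: w - t *: u) <= 4 / 100 * r * (1 - (3 / 4) ^+ k)].
Proof.
move=> r0 rd Cr u1 /andP[t0 t2] tr; elim=> [|k IH] eta eta0.
  exists (t *: u); rewrite /= !expr0 divr1 scale1r dxx gnormZ u1 mulr1 ger0_norm//.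
  by split=> //; [lra|rewrite subrr gnorm0 subrr mulr0].
have eta2 : 0 < eta / 2 by rewrite divr_gt0.
have [w /= [w1 w2 w3 w4]] := IH _ eta2.
set q := r / 2 ^+ k in w1 w2 w3.
have p2 : 0 < 2 ^+ k :> R by rewrite exprn_gt0.
have q0 : 0 < q by rewrite divr_gt0.
have qr : q <= r by rewrite /q ler_pdivrMr// (ler_peMr (ltW r0))// exprn_ege1// ler1n.
have qd : 2 * q < delta by lra.
have Cq : 20 * C * q <= 1.
  have : C * q <= C * r by rewrite ler_pM2l.
  have : 0 < C * r by rewrite mulr_gt0.
  lra.
have [w' [h1 h2 h3 h4]] := halving_direction q0 qd Cq eta2 w1 w2.
have q' : r / 2 ^+ k.+1 = q / 2 by rewrite /q exprS invfM mulrCA mulrC.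
exists w'; rewrite /= q'; split=> //; first by lra.
  by have := dT (e w) (e w') (e (t *: u)); lra.
have -> : 2 ^+ k.+1 *: w' - t *: u = 2 ^+ k *: (2 *: w' - w) + (2 ^+ k *: w - t *: u).
  by rewrite scalerBr scalerA -exprSr addrA subrK.
apply: le_trans (ND _ _) _.
(* After rescaling, the squared deviation [18 * C * q ^+ 3] becomes [18 * C * r ^+ 3 / 2 ^+ k]. The
   bound on [C * r] gives [18 * C * r <= (1 / 100) ^+ 2], and [1 / 2 <= (3 / 4) ^+ 2] gives the
   ratio of the geometric series, whose total is [4 / 100 * r]. *)
suff h : N (2 ^+ k *: (2 *: w' - w)) <= 1 / 100 * r * (3 / 4) ^+ k.
  rewrite exprS; lra.
rewrite -(ler_pXn2r (n := 2))// ?nnegrE ?gnorm_ge0//; last first.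
  by apply: mulr_ge0; [lra|apply: exprn_ge0; lra].
rewrite gnormZ (ger0_norm (ltW p2)) exprMn.
apply: (@le_trans _ _ ((2 ^+ k) ^+ 2 * (18 * C * q ^+ 3))); first by rewrite ler_wpM2l ?sqr_ge0.
have rq : r = q * 2 ^+ k by rewrite /q divfK// gt_eqF.
have -> : (2 ^+ k) ^+ 2 * (18 * C * q ^+ 3) = r ^+ 2 * (18 * C * r) * (1 / 2 ^+ k).
  rewrite {2}rq {1}rq; field.
  by rewrite gt_eqF.
have -> : (1 / 100 * r * (3 / 4) ^+ k) ^+ 2 = r ^+ 2 * (1 / 100 * (1 / 100)) * ((3 / 4) ^+ k) ^+ 2 by field.
have h5 : 1 / 2 ^+ k <= ((3 / 4) ^+ k) ^+ 2 :> R.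
  rewrite -exprM mulnC exprM mul1r -exprVn lerXn2r ?nnegrE//; first by rewrite expr2; lra.
have h6 : 18 * C * r <= 1 / 100 * (1 / 100) by lra.
have h7 : 0 <= 18 * C * r by rewrite mulr_ge0// ?mulr_ge0 ?(ltW C0) ?(ltW r0).
apply: ler_pM => //; first by rewrite mulr_ge0// sqr_ge0.
by apply: ler_wpM2l => //; exact: sqr_ge0.
Qed.

Lemma far_point_near r : (0 < m)%N -> 0 < r -> 3 * r < delta -> C * r <= 1 / 100 * (1 / 100 * (1 / 20)) ->
  forall y eta, 0 < eta -> exists x, r <= d a x /\ d x y < r + eta.
Proof.
move=> m0 r0 rd Cr y eta eta0.
have [ry|yr] := leP r (d a y).
  by exists y; rewrite dxx; split=> //; lra.
have Cr0 : 0 < C * r by rewrite mulr_gt0.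
have r2 : 0 < 2 * r < delta by lra.
have [|v yE vr] := dE r2 (q := y); first by nra.
have N0 : N 0 <= 2 * r by rewrite gnorm0; lra.
have /andP[vS _] := dN r2 N0 vr; rewrite -yE subr0 in vS.
(* If [v = 0] any direction will do; one exists because [m > 0]. *)
have [u [u1 vE]] : exists u, N u = 1 /\ v = N v *: u.
  have [->|v0] := eqVneq v 0.
    have n0 : 'e_(Ordinal m0) != 0 :> 'rV[R]_m.
      apply/eqP => /rowP /(_ (Ordinal m0)); rewrite !mxE !eqxx => /eqP.
      by rewrite oner_eq0.
    have := gnorm_gt0 Gp n0 => n1.
    exists ((N 'e_(Ordinal m0))^-1 *: 'e_(Ordinal m0)); rewrite gnorm0 scale0r; split=> //.
    by rewrite gnormZ ger0_norm ?invr_ge0 ?gnorm_ge0// mulVf// gt_eqF.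
  have n1 := gnorm_gt0 Gp v0.
  exists ((N v)^-1 *: v); split.
    by rewrite gnormZ ger0_norm ?invr_ge0 ?gnorm_ge0// mulVf// gt_eqF.
  by rewrite scalerA divff ?scale1r// gt_eqF.
have [t [t02 tr t1]] : exists t, [/\ 0 <= t <= 2 * r, d a (e (t *: u)) = r &
    99 / 100 * r <= t <= 102 / 100 * r] by apply: ray_point => //; lra.
exists (e (t *: u)); rewrite tr; split=> //.
set s := N v in vE vS vr.
have s0 : 0 <= s by exact: gnorm_ge0.
have [s00|sn0] := eqVneq s 0.
  by rewrite yE vE s00 scale0r dC tr ltrDl.
have {s0 sn0} s0 : 0 < s by rewrite lt_neqAle eq_sym sn0.
have sr : s <= 11 / 10 * r by nra.
have ex : exists k : nat, r / 2 ^+ k <= 8 * s.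
  exists (Num.bound (r / (8 * s))).
  have s8 : 0 < 8 * s by rewrite mulr_gt0.
  rewrite ler_pdivrMr ?exprn_gt0// mulrC -ler_pdivrMr//.
  apply: le_trans (ltW (archi_boundP _)) _; first by rewrite divr_ge0 ?ltW.
  by rewrite -natrX ler_nat ltnW// ltn_expl.
(* At this scale [q / 8 <= s <= 11 / 10 * q], so [y] is closer to [e w] than [a] is. *)
case: (ex_minnP ex) => k kP kmin.
have eta2 : 0 < eta / 2 by rewrite divr_gt0.
have r2d : 2 * r < delta by lra.
have [w /= [w1 w2 w3 w4]] := halving_chain r0 r2d Cr u1 t02 tr k eta2.
have p2 : 0 < 2 ^+ k :> R by rewrite exprn_gt0.
set q := r / 2 ^+ k in w1 w2 w3 kP.
have q0 : 0 < q by rewrite divr_gt0.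
have qr : q <= r by rewrite /q ler_pdivrMr// (ler_peMr (ltW r0))// exprn_ege1// ler1n.
(* For [k = 0] this is the bound on [s] in the ball; otherwise minimality of [k] gives
   [8 * s < 2 * q]. *)
have sq : s <= 11 / 10 * q.
  case: k kmin @q p2 {kP w1 w2 w3 w4 q0 qr} => [|k] kmin q p2.
    by rewrite /q expr0 divr1.
  have : ~~ (r / 2 ^+ k <= 8 * s) by apply/negP => /kmin; rewrite ltnn.
  rewrite -ltNge => h.
  have -> : q = r / 2 ^+ k / 2 by rewrite /q exprS invfM mulrCA mulrC.
  lra.
have Cq : C * q <= C * r by rewrite ler_pM2l.
have q2 : 0 < 2 * q < delta by lra.
have vq : N (s *: u) <= 2 * q.
  by rewrite gnormZ u1 mulr1 gtr0_norm//; lra.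
have /andP[_ h] := dN q2 vq w1; rewrite -vE -yE in h.
have rq : r = q * 2 ^+ k by rewrite /q divfK// gt_eqF.
have hw : N (w - (t / 2 ^+ k) *: u) <= 4 / 100 * q.
  rewrite -(ler_pM2l p2) -[X in X * _](ger0_norm (ltW p2)) -gnormZ.
  have -> : 2 ^+ k *: (w - (t / 2 ^+ k) *: u) = 2 ^+ k *: w - t *: u.
    by rewrite scalerBr scalerA mulrCA divff ?mulr1// gt_eqF.
  apply: le_trans w4 _; rewrite {1}rq.
  have -> : 2 ^+ k * (4 / 100 * q) = 4 / 100 * (q * 2 ^+ k) * 1 by ring.
  have X0 : 0 <= 4 / 100 * (q * 2 ^+ k) by rewrite mulr_ge0// mulr_ge0 ?(ltW q0) ?(ltW p2).
  have Y0 : 0 <= (3 / 4) ^+ k :> R by apply: exprn_ge0.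
  by apply: (ler_wpM2l X0); rewrite gerBl.
have [tq1 tq2] : 99 / 100 * q <= t / 2 ^+ k /\ t / 2 ^+ k <= 102 / 100 * q.
  have assoc b : b * q * 2 ^+ k = b * r by rewrite -mulrA -rq.
  by rewrite ler_pdivlMr// ler_pdivrMr// !assoc; apply/andP.
(* The deviation from the ray costs [4 / 100 * q]. Along the ray, [t / 2 ^+ k] is between
   [99 / 100 * q] and [102 / 100 * q], and [s] between [q / 8] and [11 / 10 * q], so they differ by
   at most [9 / 10 * q]. The remaining 6 percent absorb the factor [1 + C * (2 * q)]. *)
have wv : N (w - v) <= 94 / 100 * q.
  have -> : w - v = (w - (t / 2 ^+ k) *: u) + (t / 2 ^+ k - s) *: u.
    by rewrite scalerBl addrA subrK -vE.
  apply: le_trans (ND _ _) _; rewrite [X in _ + X]gnormZ u1 mulr1.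
  have : `|t / 2 ^+ k - s| <= 9 / 10 * q.
    by rewrite ler_norml; apply/andP; split; lra.
  by lra.
have yw : d y (e w) <= q.
  apply: le_trans h _; have := gnorm_ge0 G (w - v).
  have Cq1 : C * (2 * q) <= 1 / 100 by lra.
  have Cq0 : 0 <= C * (2 * q) by rewrite mulr_ge0 ?(ltW C0)//; case/andP: q2 => /ltW.
  by nra.
by rewrite dC; have := dT (e w) y (e (t *: u)); lra.
Qed.
End cover.

(** * Pushing the ball out along simplex directions *)

(** The vertex is chosen separately for each point, so [f] need not be continuous; only its
    distortion matters. The last factor 2 is there because [d_GH] is half the distortion. *)
Lemma push_out L : (0 < m)%N -> 1 < L ->
  exists r0, 0 < r0 /\ forall r, 0 < r < r0 -> exists f : M -> M,
    [/\ forall p, r <= d a (f p), forall p, r <= d a p -> f p = p &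
      forall p q, `|d p q - d (f p) (f q)| <=
        L * Num.sqrt ((m%:R + 1) / (2 * m%:R)) * r * 2].
Proof.
move=> m0 L1; have [v [v0 v1 vv]] := regular_simplex Gs Gp m0.
have mr : 0 < m%:R :> R by rewrite ltr0n.
set sg := Num.sqrt _.
have sg2 : (2 * sg) ^+ 2 = 2 * (m%:R + 1) / m%:R.
  rewrite exprMn sqr_sqrtr ?divr_ge0 ?addr_ge0 ?mulr_ge0//; field.
  by rewrite gt_eqF.
have sg0 : 0 <= sg by exact: sqrtr_ge0.
(* The edge [2 * sg] of the simplex is at least its circumradius 1; this covers pairs of which only
   one point moves. *)
have sg1 : 1 <= 2 * sg.
  rewrite -(ler_pXn2r (n := 2))// ?nnegrE ?mulr_ge0// sg2 expr1n ler_pdivlMr//.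
  by lra.
have vd i j : N (v i - v j) <= 2 * sg.
  have [->|ij] := eqVneq i j; first by rewrite subrr gnorm0 mulr_ge0.
  by rewrite -(ler_pXn2r (n := 2))// ?nnegrE ?gnorm_ge0 ?mulr_ge0// sg2 vv.
have vpos x : exists i, 0 <= bilin G x (v i).
  apply: contrapT => /forallNP neg.
  have : bilin G x (\sum_i v i) < 0.
    rewrite bilin_sumr (bigD1 None)//= ltr_wnDr//.
      by apply: sumr_le0 => i _; rewrite leNgt; apply/negP => /ltW/neg.
    by rewrite ltNge; apply/negP/neg.
  by rewrite v0 bilinC// bilin0l ltxx.
(* [14 = 2 + 12]: the [2 * k] comes from enlarging [r] to [r'], the [12 * k] from comparing
   distances with norms before the push (at most [4 * r]) and after it (at most [8 * r]). *)
pose k0 := Num.min (1 / 2) ((L - 1) / 14).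
have k00 : 0 < k0 by rewrite lt_min; apply/andP; split; lra.
exists (Num.min (delta / 4) (k0 / (4 * C))); split.
  by rewrite lt_min divr_gt0//= divr_gt0// mulr_gt0.
move=> r /andP[r0]; rewrite lt_min => /andP[rd].
rewrite ltr_pdivlMr ?mulr_gt0// => rk.
(* Points of the ball and their images have coordinates of norm at most [4 * r]; [k] is the relative
   error there. *)
pose k := C * (4 * r).
have k_0 : 0 < k by rewrite /k !mulr_gt0.
have kk0 : k <= k0 by rewrite /k; lra.
have k1 : k <= 1 / 2 by apply: le_trans kk0 _; rewrite ge_min lexx.
have kL : 14 * k <= L - 1.
  have : k <= (L - 1) / 14 by apply: le_trans kk0 _; rewrite ge_min lexx orbT.
  lra.
(* Slightly more than [r], so that the lower bound [(1 - k) * N] still places the image outside the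
   ball. *)
pose r' := r / (1 - k).
have k1' : 0 < 1 - k by lra.
have r'E : r' * (1 - k) = r by rewrite /r' divfK// gt_eqF.
have r'0 : 0 < r' by rewrite divr_gt0.
have r'2 : r' <= r * (1 + 2 * k).
  rewrite -(ler_pM2r k1') r'E.
  have rk0 : 0 < r * k by rewrite mulr_gt0.
  have : 0 <= r * k * (1 - 2 * k) by rewrite mulr_ge0 ?(ltW rk0)//; lra.
  lra.
have r'3 : r' <= 2 * r.
  by apply: le_trans r'2 _; rewrite mulrC ler_pM2r//; lra.
have r4 : 0 < 4 * r < delta by lra.
have r2 : 0 < 2 * r < delta by lra.
have N0 : N 0 <= 4 * r by rewrite gnorm0; lra.
have dN4 x y : N x <= 4 * r -> N y <= 4 * r ->
    (1 - k) * N (y - x) <= d (e x) (e y) <= (1 + k) * N (y - x) by exact: dN.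
pose P p q := (r <= d a p /\ q = p) \/
  d a p < r /\ exists x i, [/\ p = e x, N x <= r', q = e (x + r' *: v i) & 0 <= bilin G x (v i)].
have /choice[f fP] : forall p, exists q, P p q.
  move=> p; have [rp|pr] := leP r (d a p); first by exists p; left.
  have [|x pE xr] := dE r2 (q := p).
    apply: lt_le_trans pr _; have : C * (2 * r) = k / 2 by rewrite /k; field.
    move=> ->; have : k * r <= 1 / 2 * r by rewrite ler_pM2r.
    lra.
  have [i iP] := vpos x; exists (e (x + r' *: v i)); right; split=> //; exists x, i; split=> //.
  have x4 : N x <= 4 * r by lra.
  have /andP[h _] := dN4 0 x N0 x4; rewrite subr0 -pE in h.
  rewrite -(ler_pM2r k1') r'E; lra.
have Nv i : N (r' *: v i) = r' by rewrite gnormZ v1 mulr1 gtr0_norm.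
have Nxv x i : N x <= r' -> N (x + r' *: v i) <= 4 * r.
  by move=> xr; apply: le_trans (ND _ _) _; rewrite Nv; lra.
have Nx4 x : N x <= r' -> N x <= 4 * r by move=> xr; lra.
exists f; split.
- move=> p; case: (fP p) => [[rp ->]//|[_ [x [i [pE xr -> xi]]]]].
  have /andP[h _] := dN4 0 _ N0 (Nxv x i xr); rewrite subr0 in h.
  apply: le_trans h; rewrite -r'E mulrC ler_pM2l//.
  rewrite -(ler_pXn2r (n := 2))// ?nnegrE ?gnorm_ge0 ?(ltW r'0)//.
  rewrite (gnorm_sqr Gp) bilinDl !bilinDr -!(gnorm_sqr Gp) Nv bilinZl bilinZr.
  rewrite (bilinC Gs (v i)).
  have : 0 <= r' * bilin G x (v i) by rewrite mulr_ge0 ?(ltW r'0).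
  have := sqr_ge0 (N x); lra.
- by move=> p rp; case: (fP p) => [[_ ->]//|[]]; rewrite ltNge rp.
have r20 : 0 <= (1 + k) * r' by rewrite mulr_ge0 ?(ltW r'0)//; lra.
have move_le p : d p (f p) <= (1 + k) * r'.
  case: (fP p) => [[_ ->]|[_ [x [i [-> xr -> _]]]]]; first by rewrite dxx.
  have /andP[_ h] := dN4 _ _ (Nx4 _ xr) (Nxv x i xr).
  by apply: le_trans h _; rewrite addrAC subrr add0r Nv.
have Lr : r * (1 + 14 * k) <= L * r by rewrite [L * r]mulrC ler_pM2l//; lra.
have L0 : 0 < L * r by rewrite mulr_gt0//; lra.
have Lsg : L * r <= L * sg * r * 2.
  have -> : L * sg * r * 2 = L * r * (2 * sg) by ring.
  by rewrite ler_peMr// ltW.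
have bound1 : (1 + k) * r' <= L * sg * r * 2.
  apply: le_trans Lsg; apply: le_trans Lr.
  have : (1 + k) * r' <= (1 + k) * (r * (1 + 2 * k)) by rewrite ler_pM2l//; lra.
  have kr : 0 < k * r by rewrite mulr_gt0.
  have : k * (k * r) <= 1 / 2 * (k * r) by rewrite ler_pM2r.
  lra.
have dd p q o : `|d p o - d q o| <= d p q.
  rewrite ler_norml; apply/andP; split.
    by have := dT p q o; rewrite (dC q p); lra.
  by have := dT q p o; lra.
move=> p q; have move_p := move_le p; have move_q := move_le q.
(* A fixed point may lie far outside the chart; pairs containing one are handled by the triangle
   inequality alone. *)
case: (fP p) => [[_ fp]|[_ [x [i [pE xr fp _]]]]].
  rewrite fp (dC p q) (dC p (f q)); apply: le_trans (dd _ _ _) _.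
  exact: le_trans bound1.
case: (fP q) => [[_ fq]|[_ [y [j [qE yr fq _]]]]].
  rewrite fq; apply: le_trans (dd _ _ _) _; exact: le_trans bound1.
have /andP[l1 u1] := dN4 _ _ (Nx4 _ xr) (Nx4 _ yr).
have /andP[l2 u2] := dN4 _ _ (Nxv x i xr) (Nxv y j yr).
rewrite -pE -qE in l1 u1; rewrite -fp -fq in l2 u2.
set X := y - x in l1 u1; set X' := y + r' *: v j - (x + r' *: v i) in l2 u2.
have NX : N X <= 4 * r.
  by apply: le_trans (ND _ _) _; rewrite gnormN; lra.
have NX' : N X' <= 8 * r.
  apply: le_trans (ND _ _) _; rewrite gnormN.
  by have := Nxv x i xr; have := Nxv y j yr; lra.
have E : X' - X = r' *: (v j - v i).
  by apply/rowP => l; rewrite !mxE; ring.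
have NE : N (X' - X) <= r' * (2 * sg).
  by rewrite E gnormZ gtr0_norm// ler_pM2l.
have h1 : N X' <= N X + r' * (2 * sg).
  have {1}-> : X' = X + (X' - X) by rewrite addrC subrK.
  by apply: le_trans (ND _ _) _; rewrite lerD2l.
have h2 : N X <= N X' + r' * (2 * sg).
  have {1}-> : X = X' - (X' - X) by rewrite opprB addrCA subrr addr0.
  by apply: le_trans (ND _ _) _; rewrite gnormN lerD2l.
have kX : k * N X <= k * (4 * r) by rewrite ler_pM2l.
have kX' : k * N X' <= k * (8 * r) by rewrite ler_pM2l.
have h3 : r' * (2 * sg) + 12 * k * r <= L * sg * r * 2.
  have -> : L * sg * r * 2 = L * r * (2 * sg) by ring.
  apply: (@le_trans _ _ (r * (1 + 14 * k) * (2 * sg))); last by rewrite ler_wpM2r ?mulr_ge0.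
  apply: (@le_trans _ _ (r * (1 + 2 * k) * (2 * sg) + 12 * k * r * (2 * sg))); last first.
    by rewrite -mulrDl ler_wpM2r ?mulr_ge0//; lra.
  have kr0 : 0 <= 12 * k * r by rewrite mulr_ge0 ?(ltW r0)// mulr_ge0 ?(ltW k_0).
  by apply: lerD; [rewrite ler_wpM2r// mulr_ge0|rewrite ler_peMr].
by rewrite ler_norml; apply/andP; split; lra.
Qed.
End almost_euclidean.

(** * Gluing along a map of small distortion *)

(** A separate name for the disjoint union, to carry classical equality and choice structures over
    bare types. *)
Definition glue (X Y : Type) : Type := (X + Y)%type.
HB.instance Definition _ (X Y : Type) := gen_eqMixin (glue X Y).
HB.instance Definition _ (X Y : Type) := gen_choiceMixin (glue X Y).

Section gluing.
Variables (R : realType) (X Y : Type) (dX : X -> X -> R) (dY : Y -> Y -> R).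
Variables (f : X -> Y) (delta : R).
Hypotheses (dX0 : forall x, dX x x = 0) (dX_eq0 : forall x y, dX x y = 0 -> x = y)
  (dXC : forall x y, dX x y = dX y x)
  (dXT : forall y x z, dX x z <= dX x y + dX y z).
Hypotheses (dY0 : forall x, dY x x = 0) (dY_eq0 : forall x y, dY x y = 0 -> x = y)
  (dYC : forall x y, dY x y = dY y x)
  (dYT : forall y x z, dY x z <= dY x y + dY y z).
Hypothesis delta0 : 0 < delta.
Hypothesis f_surj : forall y, exists x, f x = y.
Hypothesis f_dis : forall x x', `|dX x x' - dY (f x) (f x')| <= 2 * delta.

(* Distance between the copies of [X] and [Y] in their disjoint union; the gap
   [delta] both absorbs the distortion and separates the copies. *)
Let cross x y := delta + inf [set dX x z + dY (f z) y | z in [set: X]].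

Let dX_ge0 x y : 0 <= dX x y.
Proof. by have := dXT y x x; rewrite dX0 (dXC y x); lra. Qed.

Let dY_ge0 x y : 0 <= dY x y.
Proof. by have := dYT y x x; rewrite dY0 (dYC y x); lra. Qed.

Let cross_le x y z : cross x y <= delta + (dX x z + dY (f z) y).
Proof.
rewrite lerD2l; apply: ge_inf; last by exists z.
by exists 0 => _ [w _ <-]; rewrite addr_ge0.
Qed.

Let le_cross x y k : (forall z, k <= dX x z + dY (f z) y) -> k + delta <= cross x y.
Proof.
move=> h; rewrite addrC lerD2l; apply: lb_le_inf; first by exists (dX x x + dY (f x) y), x.
by move=> _ [z _ <-].
Qed.

Let cross_gt0 x y : 0 < cross x y.
Proof.
apply: (@lt_le_trans _ _ (0 + delta)); first by rewrite add0r.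
by apply: le_cross => z; rewrite addr_ge0.
Qed.

Let crossX x x' y : cross x y <= dX x x' + cross x' y.
Proof.
suff : (cross x y - delta - dX x x') + delta <= cross x' y by lra.
by apply: le_cross => z; have := cross_le x y z; have := dXT x' x z; lra.
Qed.

Let crossY x y y' : cross x y <= cross x y' + dY y' y.
Proof.
suff : (cross x y - delta - dY y' y) + delta <= cross x y' by lra.
by apply: le_cross => z; have := cross_le x y z; have := dYT y' (f z) y; lra.
Qed.

(** The detour through [y] crosses the gap twice, and the [2 * delta] so collected pays for
    replacing [dY (f z) (f z')] by [dX z z']. *)
Let crossXX x x' y : dX x x' <= cross x y + cross x' y.
Proof.
suff : (dX x x' - cross x' y - delta) + delta <= cross x y by lra.
apply: le_cross => z.
suff : (dX x x' - delta - delta - (dX x z + dY (f z) y)) + delta <= cross x' y by lra.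
apply: le_cross => z'.
have := f_dis z z'; rewrite ler_norml => /andP[_].
have := dXT z x x'; have := dXT z' z x'; have := dYT y (f z) (f z').
by rewrite (dXC z' x') (dYC y); lra.
Qed.

Let crossYY x y y' : dY y y' <= cross x y + cross x y'.
Proof.
suff : (dY y y' - cross x y' - delta) + delta <= cross x y by lra.
apply: le_cross => z.
suff : (dY y y' - delta - delta - (dX x z + dY (f z) y)) + delta <= cross x y' by lra.
apply: le_cross => z'.
have := f_dis z z'; rewrite ler_norml => /andP[+ _].
have := dYT (f z) y y'; have := dYT (f z') (f z) y'; have := dXT x z z'.
by rewrite (dXC z x) (dYC y (f z)); lra.
Qed.

Let D (u v : glue X Y) : R :=
  match u, v with
  | inl x, inl x' => dX x x'
  | inr y, inr y' => dY y y'
  | inl x, inr y | inr y, inl x => cross x y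
  end.

Let Dxx u : D u u = 0. Proof. by case: u => ?; rewrite /D. Qed.

Let DC u v : D u v = D v u. Proof. by case: u => ?; case: v => ?; rewrite /D. Qed.

Let D_eq0 u v : D u v = 0 -> u = v.
Proof.
case: u => x; case: v => y; rewrite /D.
- by move=> /dX_eq0 ->.
- by move=> h; have := cross_gt0 x y; rewrite h ltxx.
- by move=> h; have := cross_gt0 y x; rewrite h ltxx.
- by move=> /dY_eq0 ->.
Qed.

Let DT v u w : D u w <= D u v + D v w.
Proof.
case: u => x; case: v => y; case: w => z; rewrite /D.
- exact: dXT.
- exact: crossX.
- exact: crossXX.
- exact: crossY.
- by rewrite addrC dXC; exact: crossX.
- exact: crossYY.
- by rewrite addrC dYC; exact: crossY.
- exact: dYT.
Qed.

(** The graph of the surjection [f] is a correspondence of distortion at most [2 * delta]. In the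
    glued space [x] and [f x] are at distance at most [delta]; the strict inequality in
    [hausdorff_dist] costs an arbitrary [eps]. *)
Lemma gromov_hausdorff_le : (gromov_hausdorff_dist dY dX <= delta%:E)%E.
Proof.
pose Z : metricType R := HB.pack (glue X Y) (isMetric.Build R (glue X Y) Dxx D_eq0 DC DT).
apply: (@le_trans _ _ (hausdorff_dist (@mdist R Z) (range (inr : Y -> Z)) (range (inl : X -> Z)))).
  by apply: ereal_inf_lbound; exists Z, (inr : Y -> Z), (inl : X -> Z); split.
apply/lee_addgt0Pr => eps eps0; apply: ereal_inf_lbound; exists (delta + eps) => //.
have key x : cross x (f x) < delta + eps.
  by apply: le_lt_trans (cross_le _ _ x) _; rewrite dX0 dY0 addr0 addr0 ltrDl.
split; first by rewrite addr_gt0.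
- by move=> _ [y _ <-]; have [x <-] := f_surj y; exists (inl x : Z) => //; exact: key.
- by move=> _ [x _ <-]; exists (inr (f x) : Z) => //; exact: key.
Qed.

End gluing.

Theorem theorem3p6 (R : realType) (m : nat) (hm : (1 <= m)%N)
    (M : topologicalType) (S : smooth_manifold R m M) (g : riemannian_metric S)
    (hM : connected [set: M]) (a : M) (L : R) (hL : 1 < L) :
  exists r0 : R, 0 < r0 /\
    forall r : R, 0 < r < r0 ->
      let A : set M := ~` rball g a r in
      (gromov_hausdorff_dist (@subspace_dist R M (rdist g) A) (rdist g) <=
         (L * Num.sqrt ((m%:R + 1) / (2 * m%:R)))%:E *
         hausdorff_dist (rdist g) A [set: M])%E /\
      hausdorff_dist (rdist g) A [set: M] = r%:E.
Proof.
have [C [delta [C0 delta0 dN dE]]] := rdist_local g hM a.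
have Gs := gram_at_sym g a.
have Gp := @gram_at_pos _ _ _ _ g a.
have dxx := rdistxx g.
have dC := rdistC g hM; have dT := rdist_triangle g hM.
have e0 := echart0 S a.
have dE' r q : 0 < r < delta -> rdist g (echart S a 0) q < (1 - C * r) * r ->
    exists2 x, q = echart S a x & gnorm (gram_at g a) x <= r by rewrite e0; exact: dE.
have [r1 [r10 push]] := push_out dxx dC dT Gs Gp C0 delta0 dN dE' hm hL.
(* The bound on [C * r] under which [far_point_near] applies. *)
pose b := 1 / 100 * (1 / 100 * (1 / 20)) : R.
have b0 : 0 < b by rewrite !mulr_gt0.
exists (Num.min r1 (Num.min (delta / 3) (b / C))); split.
  by rewrite !lt_min r10 !divr_gt0.
move=> r /andP[r0]; rewrite !lt_min => /andP[rr1 /andP[rd rC]] A.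
have Cr : C * r <= b by rewrite mulrC -ler_pdivlMr// ltW.
have far := far_point_near dxx dC dT Gs Gp C0 dN dE' (rdist_midpoint g hM) hm r0 _ Cr.
rewrite e0 in far push.
have inA p : A p <-> r <= rdist g a p by rewrite /A /rball /= leNgt; split => /negP.
have dH : hausdorff_dist (rdist g) A [set: M] = r%:E.
  apply/eqP; rewrite eq_le; apply/andP; split.
    apply/lee_addgt0Pr => eps eps0; apply: ereal_inf_lbound; exists (r + eps) => //.
    split; first by rewrite addr_gt0.
      by move=> x _; exists x => //; rewrite dxx addr_gt0.
    move=> y _; have [|x [/inA Ax xy]] := far _ y eps eps0; first by lra.
    by exists x.
  apply: le_ereal_inf_tmp => _ [e [ep _ h] <-].
  have [x /inA Ax xa] := h a I; rewrite lee_fin dC in xa *.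
  exact: le_trans Ax (ltW xa).
split=> //; rewrite dH -EFinM.
have rr : 0 < r < r1 by rewrite r0.
have [f [fA fid fdis]] := push r rr.
have fA' p : f p \in A by apply: mem_set; apply/inA.
have sg0 : 0 < Num.sqrt ((m%:R + 1) / (2 * m%:R) : R).
  by rewrite sqrtr_gt0 divr_gt0 ?addr_gt0 ?mulr_gt0 ?ltr0n.
(* [M] is glued to [A] along the push, which is onto because it fixes the points of [A]. *)
apply: (@gromov_hausdorff_le _ _ _ _ _ (fun p => exist _ (f p) (fA' p) : A)) => //.
- exact: rdist_eq0.
- by move=> p; exact: dxx.
- by move=> p q /rdist_eq0 pq; apply: val_inj; exact: pq.
- by move=> p q; exact: dC.
- by move=> p q s; exact: dT.
- by rewrite !mulr_gt0//; lra.
- move=> y; exists (val y); apply: val_inj => /=; apply: fid.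
  by apply/inA; apply: set_mem; exact: valP y.
- by move=> p q; rewrite mulrC; exact: fdis.
Qed.
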